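(* Let $(L^k,g)$ and $(M^n,h)$ be oriented Riemannian manifolds, not necessarily compact, with $2\le k\le n$. Let $\alpha\in\Omega^k(M)$ be a calibration and let $u\colon(L,g)\to(M,h)$ be a Smith immersion with respect to $\alpha$. If $d\alpha=0$, then $u$ is $k$-harmonic in the sense that its $k$-tension vanishes: $$\tau_k(u)=\operatorname{div}(|du|^{k-2}du)=0\in\Gamma(u^*TM).$$
   Context: A form $\alpha\in\Omega^k(M)$ is a calibration if $\alpha(e_1,\dots,e_k)\le 1$ for all orthonormal $e_1,\dots,e_k\in T_xM$, $x\in M$. $|du|^2=\operatorname{tr}_g(u^*h)$. A smooth map $u\colon(L^k,g)\to(M^n,h)$ is a Smith immersion with respect to $\alpha$ if $u^*\alpha=\frac{1}{(\sqrt k)^k}|du|^k\,\mathrm{vol}_L$ and $u^*h=\frac1k|du|^2g$ at all points of $L$ ($du$ may vanish at some points). For a section $A$ of $T^*L\otimes u^*TM$, $\operatorname{div}A=\sum_i(\nabla_{e_i}A)(e_i)$, with $(e_i)$ a local $g$-orthonormal frame and $\nabla$ the connection induced by the Levi-Civita connection of $L$ and the pullback of the Levi-Civita connection of $M$. *)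

(* Defs.v *)
From HB Require Import structures.
From mathcomp Require Import all_boot all_order all_algebra.
From mathcomp Require Import all_classical all_reals all_analysis.
From mathcomp Require Import lra.

Set Implicit Arguments.
Unset Strict Implicit.
Unset Printing Implicit Defensive.

Import Order.TTheory GRing.Theory Num.Theory.
Import numFieldNormedType.Exports.

Local Open Scope classical_set_scope.
Local Open Scope ring_scope.

(* Conventions.  Tangent vectors are written in a chart as row vectors, a      *)
(* family of m tangent vectors is the m x n matrix of its rows, and a linear   *)
(* map acts on row vectors from the right, as the library's 'J f x does.       *)
(* A tensor field is the family, indexed by the charts i of the atlas, of its  *)
(* components at the points p of the domain of i, subject to the usual         *)
(* transformation law; values outside the domain are irrelevant.               *)

Section Smooth.
Variables (R : realType) (V W : normedModType R).

(* to be used with an open set U *)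
Fixpoint C_on (m : nat) (U : set V) (f : V -> W) : Prop :=
  match m with
  | 0 => forall x, U x -> {for x, continuous f}
  | m'.+1 => (forall x, U x -> differentiable f x) /\
             (forall v, C_on m' U (fun x => 'D_v f x))
  end.

Definition smooth_on (U : set V) (f : V -> W) := forall m, C_on m U f.

End Smooth.

Record manifold (R : realType) (n : nat) := Manifold {
  manifold_space :> topologicalType ;
  manifold_hausdorff : hausdorff_space manifold_space ;
  manifold_second_countable : @second_countable manifold_space ;
  chart : Type ;
  chart_dom : chart -> set manifold_space ;
  chart_map : chart -> manifold_space -> 'rV[R]_n ;
  chart_inv : chart -> 'rV[R]_n -> manifold_space ;
  chart_cover : forall p, exists i, chart_dom i p ;
  chart_dom_open : forall i, open (chart_dom i) ;
  chart_im_open : forall i, open (chart_map i @` chart_dom i) ;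
  chart_mapK : forall i p, chart_dom i p -> chart_inv i (chart_map i p) = p ;
  chart_map_continuous : forall i p, chart_dom i p ->
    {for p, continuous (chart_map i)} ;
  chart_inv_continuous : forall i p, chart_dom i p ->
    {for chart_map i p, continuous (chart_inv i)} ;
  chart_smooth : forall i j,
    smooth_on (chart_map i @` (chart_dom i `&` chart_dom j))
              (chart_map j \o chart_inv i)
}.

Section Manifold.
Variables (R : realType) (n : nat) (M : manifold R n).
Implicit Types (i j : chart M) (p : M).

Definition chart_change i j p : 'M[R]_n :=
  'J (chart_map j \o chart_inv i) (chart_map i p).

(* The orientation is the one for which all charts of the atlas are positive.  *)
Definition oriented := forall i j p, chart_dom i p -> chart_dom j p ->
  0 < \det (chart_change i j p).

Record riemannian_metric := RiemannianMetric {
  metric :> chart M -> M -> 'M[R]_n ;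
  metric_change : forall i j p, chart_dom i p -> chart_dom j p ->
    metric i p = chart_change i j p *m metric j p *m (chart_change i j p)^T ;
  metric_sym : forall i p, chart_dom i p -> (metric i p)^T = metric i p ;
  metric_pos : forall i p, chart_dom i p -> forall v : 'rV[R]_n, v != 0 ->
    0 < (v *m metric i p *m v^T) 0 0 ;
  metric_smooth : forall i,
    smooth_on (chart_map i @` chart_dom i) (metric i \o chart_inv i)
}.

Record diff_form (m : nat) := DiffForm {
  form :> chart M -> M -> 'M[R]_(m, n) -> R ;
  form_change : forall i j p, chart_dom i p -> chart_dom j p ->
    forall X, form i p X = form j p (X *m chart_change i j p) ;
  form_multilinear : forall i p, chart_dom i p ->
    forall (X Y Z : 'M[R]_(m, n)) (s : 'I_m) (b c : R),
    row s X = b *: row s Y + c *: row s Z ->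
    row' s Y = row' s X -> row' s Z = row' s X ->
    form i p X = b * form i p Y + c * form i p Z ;
  form_alternate : forall i p, chart_dom i p ->
    forall (X : 'M[R]_(m, n)) (s t : 'I_m), s != t -> row s X = row t X ->
    form i p X = 0 ;
  form_smooth : forall i X,
    smooth_on (chart_map i @` chart_dom i) (fun y => form i (chart_inv i y) X)
}.

(* The invariant formula for d applied to vector fields with constant          *)
(* components in the chart i, whose Lie brackets vanish.                       *)
Definition ext_deriv m (w : diff_form m) i p (X : 'M[R]_(m.+1, n)) : R :=
  \sum_(s < m.+1) (-1) ^+ s *
    'D_(row s X) (fun y => w i (chart_inv i y) (row' s X)) (chart_map i p).

Definition closed_form m (w : diff_form m) :=
  forall i p, chart_dom i p -> forall X, ext_deriv w i p X = 0.

Variable h : riemannian_metric.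

Definition orthonormal m i p (E : 'M[R]_(m, n)) := E *m h i p *m E^T = 1%:M.

Definition calibration m (w : diff_form m) :=
  forall i p, chart_dom i p ->
  forall E, orthonormal i p E -> w i p E <= 1.

(* relative to the orientation given by the atlas *)
Definition vol_form i p (X : 'M[R]_n) : R := Num.sqrt (\det (h i p)) * \det X.

Definition metric_deriv i p (a b c : 'I_n) : R :=
  'D_(delta_mx 0 a) (fun y => h i (chart_inv i y) b c) (chart_map i p).

(* Gamma^d_{ab} for the Levi-Civita connection; see christoffelP *)
Definition christoffel i p (a b d : 'I_n) : R :=
  2^-1 * \sum_(c < n) invmx (h i p) d c *
    (metric_deriv i p a b c + metric_deriv i p b a c - metric_deriv i p c a b).

(* nabla_v (partial_b) = \sum_d (connection i p v) b d * partial_d *)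
Definition connection i p (v : 'rV[R]_n) : 'M[R]_n :=
  \matrix_(b, d) \sum_(a < n) v 0 a * christoffel i p a b d.

End Manifold.

Section Map.
Variables (R : realType) (k n : nat) (L : manifold R k) (M : manifold R n).
Variables (g : riemannian_metric L) (h : riemannian_metric M).
Variable u : L -> M.
Implicit Types (i : chart L) (j : chart M) (p : L).

Definition smooth_map := continuous u /\
  forall i j, smooth_on (chart_map i @` (chart_dom i `&` u @^-1` chart_dom j))
                        (chart_map j \o u \o chart_inv i).

(* Components of the section du of T^*L (x) u^*TM: the row a is the image of   *)
(* the a-th coordinate vector of the chart i, read in the chart j.             *)
Definition du i j p : 'M[R]_(k, n) :=
  'J (chart_map j \o u \o chart_inv i) (chart_map i p).

Definition pullback_form m (w : diff_form M m) i j p (X : 'M[R]_(m, k)) : R :=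
  w j (u p) (X *m du i j p).

Definition pullback_metric i j p : 'M[R]_k :=
  du i j p *m h j (u p) *m (du i j p)^T.

(* |du|^2 = tr_g (u^* h) *)
Definition du_norm2 i j p : R := \tr (invmx (g i p) *m pullback_metric i j p).

Definition du_norm i j p : R := Num.sqrt (du_norm2 i j p).

Definition smith_immersion (alpha : diff_form M k) :=
  smooth_map /\
  forall i j p, chart_dom i p -> chart_dom j (u p) ->
    (forall X, pullback_form alpha i j p X =
       (Num.sqrt k%:R ^+ k)^-1 * du_norm i j p ^+ k * vol_form g i p X) /\
    pullback_metric i j p = (k%:R^-1 * du_norm2 i j p) *: g i p.

(* For a section A of T^*L (x) u^*TM, given by its components in charts as du  *)
(* is, nabla_v A with respect to the Levi-Civita connection of g and the       *)
(* pullback by u of that of h, again in components.                            *)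
Definition cov_deriv (A : chart L -> chart M -> L -> 'M[R]_(k, n)) i j p
    (v : 'rV[R]_k) : 'M[R]_(k, n) :=
  'D_v (A i j \o chart_inv i) (chart_map i p)
  - connection g i p v *m A i j p
  + A i j p *m connection h j (u p) (v *m du i j p).

(* \sum_s (nabla_{e_s} A)(e_s), where e_s is the row s of E, an orthonormal    *)
(* basis of the tangent space at p.                                            *)
Definition divergence (A : chart L -> chart M -> L -> 'M[R]_(k, n)) i j p
    (E : 'M[R]_k) : 'rV[R]_n :=
  \sum_(s < k) row s E *m cov_deriv A i j p (row s E).

(* For smooth u the section |du|^{k-2} du is of class C^1, also where du = 0,   *)
(* so that the derivative in [cov_deriv] exists.                               *)
Definition k_tension :=
  divergence (fun i j p => du_norm i j p ^+ (k - 2) *: du i j p).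

Definition k_harmonic := forall i j p, chart_dom i p -> chart_dom j (u p) ->
  forall E, orthonormal g i p E -> k_tension i j p E = 0.

End Map.

Section Facts.
Variables (R : realType) (n : nat) (M : manifold R n) (h : riemannian_metric M).
Variables (i : chart M) (p : M) (ip : chart_dom i p).

Lemma metric_unit : h i p \in unitmx.
Proof.
rewrite -row_free_unit -kermx_eq0; apply/eqP/row_matrixP => s.
rewrite row0; apply/eqP/negPn/negP => v0.
have := metric_pos h ip v0.
by rewrite -row_mul mulmx_ker row0 mul0mx mxE ltxx.
Qed.

Lemma metric_symE b c : h i p b c = h i p c b.
Proof. by rewrite -{1}(metric_sym h ip) mxE. Qed.

Lemma metric_deriv_sym a b c :
  metric_deriv h i p a b c = metric_deriv h i p a c b.
Proof.
apply: near_eq_derive.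
have : nbhs (chart_map i p) (chart_map i @` chart_dom i).
  by apply: open_nbhs_nbhs; split; [exact: chart_im_open | exists p].
apply: filterS => _ [q iq <-].
by rewrite chart_mapK // -{1}(metric_sym h iq) mxE.
Qed.

Lemma christoffel_lowered a b c :
  \sum_d christoffel h i p a b d * h i p d c =
  2^-1 * (metric_deriv h i p a b c + metric_deriv h i p b a c
          - metric_deriv h i p c a b).
Proof.
pose F e := metric_deriv h i p a b e + metric_deriv h i p b a e
            - metric_deriv h i p e a b.
rewrite -/(F c).
under eq_bigr do rewrite /christoffel -mulrA mulr_suml.
rewrite -mulr_sumr exchange_big /=; congr (_ * _).
transitivity (\sum_e F e * (h i p *m invmx (h i p)) c e).
  apply: eq_bigr => e _; rewrite mxE mulr_sumr; apply: eq_bigr => d _.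
  by rewrite (metric_symE c d) -/(F e) mulrAC mulrC [h i p d c * _]mulrC.
rewrite mulmxV ?metric_unit // (bigD1 c) //= mxE eqxx mulr1.
rewrite big1 ?addr0 // => e ec.
by rewrite mxE eq_sym (negbTE ec) mulr0.
Qed.

(* [christoffel] is the unique torsion-free metric connection. *)
Lemma christoffelP (G : 'I_n -> 'I_n -> 'I_n -> R) :
  ((forall a b d, G a b d = G b a d) /\
   (forall a b c, metric_deriv h i p a b c =
      \sum_d G a b d * h i p d c + \sum_d G a c d * h i p b d))
  <-> (forall a b d, G a b d = christoffel h i p a b d).
Proof.
have cS a b d : christoffel h i p a b d = christoffel h i p b a d.
  congr (_ * _); apply: eq_bigr => c _; congr (_ * _).
  by rewrite (metric_deriv_sym c a b) (addrC (metric_deriv h i p a b c)).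
split=> [[GS Gm] a b d | GE]; last first.
  split=> [a b d | a b c]; first by rewrite !GE cS.
  under eq_bigr do rewrite GE.
  under [X in _ = _ + X]eq_bigr do rewrite GE (metric_symE b).
  rewrite !christoffel_lowered (metric_deriv_sym a c b); lra.
pose H := h i p.
have low a' b' c : \sum_e G a' b' e * H e c =
    \sum_e christoffel h i p a' b' e * H e c.
  rewrite christoffel_lowered.
  have Gl x y z : metric_deriv h i p x y z =
      \sum_e G x y e * H e z + \sum_e G x z e * H e y.
    by rewrite Gm; congr (_ + _); apply: eq_bigr => e _; rewrite metric_symE.
  have GlS x y z : \sum_e G x y e * H e z = \sum_e G y x e * H e z.
    by apply: eq_bigr => e _; rewrite GS.
  rewrite (Gl a') (Gl b') (Gl c) (GlS b' a') (GlS c a') (GlS c b'); lra.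
have rowE : (\row_e G a b e) *m H = (\row_e christoffel h i p a b e) *m H.
  apply/rowP => c; rewrite !mxE.
  by under eq_bigr do rewrite mxE; rewrite low; apply: eq_bigr => e _; rewrite mxE.
have := congr1 (mulmxr (invmx H)) rowE; rewrite /= !mulmxK ?metric_unit //.
by move/rowP/(_ d); rewrite !mxE.
Qed.

Lemma vol_form_orthonormal (E : 'M[R]_n) :
  orthonormal h i p E -> 0 < \det E -> vol_form h i p E = 1.
Proof.
move=> /(congr1 determinant); rewrite !det_mulmx det_tr det1 => e1 dE.
have hE : \det (h i p) = (\det E ^- 2).
  have dE0 : \det E != 0 by rewrite gt_eqF.
  apply: (mulIf (expf_neq0 2 dE0)); rewrite mulVf ?expf_neq0 //.
  by rewrite expr2 mulrA [\det (h i p) * _]mulrC.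
rewrite /vol_form hE -exprVn sqrtr_sqr ger0_norm ?invr_ge0 ?ltW //.
by rewrite mulVf ?gt_eqF.
Qed.

(* An orthonormal basis contracts to the inverse metric, so that [divergence]  *)
(* does not depend on it.                                                      *)
Lemma orthonormal_inv (E : 'M[R]_n) :
  orthonormal h i p E -> E^T *m E = invmx (h i p).
Proof.
move=> oE; have E1 : E^T *m (E *m h i p) = 1%:M by apply: mulmx1C.
by rewrite -[LHS](mulmxK metric_unit) -(mulmxA E^T) E1 mul1mx.
Qed.

End Facts.

(* Main.v *)
(* In charts, let f be the expression of u, J its Jacobian, G and H the metrics
   and a the form alpha.  The calibration inequality says that
   a(y, A) <= sqrt (det (A H(y) A^T)) for every family A of k vectors at y, and
   a Smith immersion attains equality at (y, A) = (f x, J x) for every x.  Where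
   J x != 0 both sides are differentiable in (y, A), so their first derivatives
   agree there (where J x = 0 both sides of the resulting identities vanish):
   the A-derivative identifies |du|^(k-2) du, up to the metrics and a constant,
   with the components a(J_1, .., e_b, .., J_k), and the y-derivative does the
   same for the derivative of H.  As the integral of a closed form is a null
   Lagrangian -- the divergence of a(J_1, .., e_b, .., J_k) is the derivative of
   a(., J) along e_b, by closedness, alternation and the symmetry of second
   derivatives -- the Euler-Lagrange equation of the k-energy follows, and that
   is the vanishing of the k-tension. *)

Require Import Defs.
From HB Require Import structures.
From mathcomp Require Import all_boot all_order all_algebra all_fingroup.
From mathcomp Require Import all_classical all_reals all_analysis.
From mathcomp Require Import lra ring.

Set Implicit Arguments.
Unset Strict Implicit.
Unset Printing Implicit Defensive.

Import Order.TTheory GRing.Theory Num.Theory.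
Import numFieldNormedType.Exports.

Local Open Scope classical_set_scope.
Local Open Scope ring_scope.

(** * Alternating forms and positive definite matrices *)

Section SetRow.
Variables (R : comNzRingType) (m n : nat).
Implicit Types (X : 'M[R]_(m, n)) (v w : 'rV[R]_n) (s t : 'I_m).

Definition set_row s v X : 'M[R]_(m, n) :=
  \matrix_(t, j) if t == s then v 0 j else X t j.

Lemma row_set_row s v X : row s (set_row s v X) = v.
Proof. by apply/rowP => j; rewrite !mxE eqxx. Qed.

Lemma row_set_row_neq s t v X : t != s -> row t (set_row s v X) = row t X.
Proof. by move=> ts; apply/rowP => j; rewrite !mxE (negbTE ts). Qed.

Lemma row'_set_row s v X : row' s (set_row s v X) = row' s X.
Proof. by apply/matrixP => t j; rewrite !mxE eq_sym (negbTE (neq_lift _ _)). Qed.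

Lemma set_row_row s X : set_row s (row s X) X = X.
Proof. by apply/matrixP => t j; rewrite !mxE; case: eqP => // ->. Qed.

Lemma set_rowC s t v w X : s != t ->
  set_row s v (set_row t w X) = set_row t w (set_row s v X).
Proof.
move=> st; apply/matrixP => r j; rewrite !mxE.
by case: (eqVneq r s) => [->|//]; rewrite (negbTE st).
Qed.

End SetRow.

Section Multilinear.
Variables (R : comNzRingType).

(** Stated through [row] and [row'], in the shape of [determinant_multilinear] and
    [form_multilinear], so that both apply as they are; [multilinearP] turns it into substitution of
    a row by [set_row]. *)
Definition multilinear m n (F : 'M[R]_(m, n) -> R) :=
  forall (X Y Z : 'M[R]_(m, n)) (s : 'I_m) (b c : R),
  row s X = b *: row s Y + c *: row s Z ->
  row' s Y = row' s X -> row' s Z = row' s X ->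
  F X = b * F Y + c * F Z.

Definition alternating m n (F : 'M[R]_(m, n) -> R) :=
  forall (X : 'M[R]_(m, n)) (s t : 'I_m), s != t -> row s X = row t X ->
  F X = 0.

Lemma det_multilinear n : multilinear (@determinant R n).
Proof.
move=> X Y Z s b c e1 e2 e3.
exact: determinant_multilinear e2 e3.
Qed.

Section OneForm.
Variables (m n : nat) (F : 'M[R]_(m, n) -> R).
Hypothesis Fm : multilinear F.
Implicit Types (X : 'M[R]_(m, n)) (v w : 'rV[R]_n) (s t : 'I_m).

Lemma multilinearP s b c v w X :
  F (set_row s (b *: v + c *: w) X) =
  b * F (set_row s v X) + c * F (set_row s w X).
Proof. by apply: (Fm (s := s)); rewrite ?row_set_row ?row'_set_row. Qed.

Lemma multilinearD s v w X :
  F (set_row s (v + w) X) = F (set_row s v X) + F (set_row s w X).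
Proof. by have := multilinearP s 1 1 v w X; rewrite !scale1r !mul1r. Qed.

Lemma multilinear0 s X : F (set_row s 0 X) = 0.
Proof.
by have := multilinearP s 0 0 0 0 X; rewrite !scale0r addr0 !mul0r addr0.
Qed.

Lemma multilinear_row0 s X : row s X = 0 -> F X = 0.
Proof. by move=> e; rewrite -(set_row_row s X) e multilinear0. Qed.

Lemma multilinearZ s b v X :
  F (set_row s (b *: v) X) = b * F (set_row s v X).
Proof.
by have := multilinearP s b 0 v 0 X; rewrite !scale0r addr0 mul0r addr0.
Qed.

Lemma multilinear_sum s (I : Type) (r : seq I) (P : pred I)
    (v : I -> 'rV[R]_n) X :
  F (set_row s (\sum_(i <- r | P i) v i) X) =
  \sum_(i <- r | P i) F (set_row s (v i) X).
Proof.
elim/big_rec2: _ => [|i x y _ <-]; first exact: multilinear0.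
by rewrite multilinearD.
Qed.

Lemma multilinear_delta s v X :
  F (set_row s v X) = \sum_j v 0 j * F (set_row s (delta_mx 0 j) X).
Proof.
rewrite {1}(row_sum_delta v) multilinear_sum.
by apply: eq_bigr => j _; rewrite multilinearZ.
Qed.

Hypothesis Fa : alternating F.

Lemma alternatingP s t v X : s != t -> F (set_row s v (set_row t v X)) = 0.
Proof.
move=> st; apply: (Fa st); rewrite row_set_row row_set_row_neq 1?eq_sym //.
by rewrite row_set_row.
Qed.

Lemma alternatingC s t v w X : s != t ->
  F (set_row s v (set_row t w X)) = - F (set_row s w (set_row t v X)).
Proof.
move=> st; apply/eqP; rewrite -addr_eq0; apply/eqP.
have := alternatingP (v + w) X st.
rewrite multilinearD !(set_rowC _ _ _ st) !multilinearD -!(set_rowC _ _ _ st).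
by rewrite !alternatingP // add0r addr0.
Qed.

(** Induction on a decomposition of [p] into transpositions; each one exchanges two rows, which
    [alternatingC] handles. *)
Lemma alternating_perm (p : 'S_m) X : F (row_perm p X) = (-1) ^+ p * F X.
Proof.
have [ts -> {p} dts] := prod_tpermP p.
elim: ts dts => [_|[s t] ts IH /= /andP[st dts]].
  by rewrite big_nil row_perm1 odd_perm1 expr0 mul1r.
rewrite big_cons row_permM odd_mul_tperm st signr_addb expr1 -mulrA -IH //= mulN1r.
set Y := row_perm _ X; have -> : row_perm (tperm s t) Y =
    set_row s (row t Y) (set_row t (row s Y) Y).
  apply/matrixP => r j; rewrite !mxE.
  case: tpermP => [->|->|/eqP rs /eqP rt]; first by rewrite eqxx.
    by rewrite eq_sym (negbTE st) eqxx.
  by rewrite (negbTE rs) (negbTE rt).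
rewrite alternatingC // !set_row_row //.
Qed.

End OneForm.

Lemma row'_col_mx m n (v : 'rV[R]_n) (A B : 'M[R]_(m, n)) (s : 'I_m) :
  row' s A = row' s B ->
  row' (rshift 1 s) (col_mx v A) = row' (rshift 1 s) (col_mx v B).
Proof.
move=> /row'_eq AB; apply/matrixP => t j; rewrite [LHS]mxE [RHS]mxE.
move: (lift _ t) (neq_lift (rshift 1 s) t) => r'.
case: (split_ordP r') => r -> rs.
  by rewrite !col_mxEu.
by rewrite !col_mxEd; apply: AB; rewrite inE; apply: contra rs => /eqP->.
Qed.

Lemma col_mx_ord0 m n (v : 'rV[R]_n) (A : 'M[R]_(m, n)) j :
  col_mx v A (ord0 : 'I_m.+1) j = v 0 j.
Proof.
have -> : ord0 = lshift m (ord0 : 'I_1) by apply: val_inj.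
exact: col_mxEu.
Qed.

Lemma col_mx_lift0 m n (v : 'rV[R]_n) (A : 'M[R]_(m, n)) t j :
  col_mx v A (lift ord0 t : 'I_m.+1) j = A t j.
Proof.
have -> : lift ord0 t = rshift 1 t by apply: val_inj.
exact: col_mxEd.
Qed.

Definition select_mx m n (phi : {ffun 'I_m -> 'I_n}) : 'M[R]_(m, n) :=
  \matrix_(s, j) (j == phi s)%:R.

(** Induction on the number of rows: the first row is expanded in the standard basis, and each
    coefficient is a multilinear form in the remaining rows. The finite sum later reduces
    differentiation of [F] to that of finitely many coefficients and of the entries of [X]. *)
Lemma multilinear_expand m n (F : 'M[R]_(m, n) -> R) X : multilinear F ->
  F X = \sum_(phi : {ffun 'I_m -> 'I_n})
    (\prod_s X s (phi s)) * F (select_mx phi).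
Proof.
elim: m F X => [|m IH] F X Fm.
  pose phi0 : {ffun 'I_0 -> 'I_n} := ffun0 (card_ord 0).
  rewrite (big_pred1 phi0) => [|phi]; last first.
    by apply/esym/eqP/ffunP => -[].
  by rewrite big_ord0 mul1r; congr F; apply/matrixP => -[].
have Fcm j : multilinear (fun Y : 'M[R]_(m, n) =>
    F (col_mx (delta_mx 0 j : 'rV_n) Y : 'M[R]_(1 + m, n))).
  move=> A B C s b c e1 e2 e3; apply: (Fm _ _ _ (rshift 1 s)).
  - apply: (etrans (rowKd _ _ _)); rewrite e1.
    by congr (_ *: _ + _ *: _); apply/esym; exact: rowKd.
  - exact: row'_col_mx e2.
  - exact: row'_col_mx e3.
rewrite -{1}(set_row_row ord0 X) multilinear_delta //.
(* A choice function on [m.+1] rows is a choice for the first row together with a choice function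
   for the others. *)
pose h (p : 'I_n * {ffun 'I_m -> 'I_n}) : {ffun 'I_m.+1 -> 'I_n} :=
  [ffun s => oapp p.2 p.1 (unlift ord0 s)].
rewrite (reindex h) /=; last first.
  exists (fun phi => (phi ord0, [ffun s => phi (lift ord0 s)]))
    => [[j phi] _|phi _].
    rewrite /h ffunE unlift_none /=; congr pair.
    by apply/ffunP => s; rewrite !ffunE liftK.
  apply/ffunP => s; rewrite !ffunE.
  by case: unliftP => [t ->|->] //=; rewrite ffunE.
rewrite -(pair_bigA _ (fun j phi =>
  (\prod_s X s (h (j, phi) s)) * F (select_mx (h (j, phi))))) /=.
apply: eq_bigr => j _; rewrite mxE.
have -> : set_row ord0 (delta_mx 0 j) X =
   (col_mx (delta_mx 0 j : 'rV_n) (row' ord0 X) : 'M[R]_(1 + m, n)).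
  apply/matrixP => s l; rewrite mxE; case: (unliftP ord0 s) => [t ->|->].
    rewrite eq_sym (negbTE (neq_lift _ _)).
    by apply/esym/(etrans (col_mx_lift0 _ _ _ _)); rewrite mxE.
  by rewrite eqxx; apply/esym/(etrans (col_mx_ord0 _ _ _)).
rewrite (IH _ _ (Fcm j)) mulr_sumr; apply: eq_bigr => phi _.
rewrite mulrA big_ord_recl !ffunE unlift_none /=; congr (_ * _ * _).
  by apply: eq_bigr => s _; rewrite !ffunE liftK !mxE.
congr F; apply/matrixP => s l; rewrite [RHS]mxE ffunE.
case: unliftP => [t ->|->] /=.
  by apply: (etrans (col_mx_lift0 _ _ _ _)); rewrite mxE.
by apply: (etrans (col_mx_ord0 _ _ _)); rewrite mxE eqxx.
Qed.

(** The form is multilinear in the rows of [Q] too. In its expansion alternation kills every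
    non-injective choice function, and the permutations that remain give the Leibniz formula for the
    determinant. *)
Lemma alternating_mulmx m n (F : 'M[R]_(m, n) -> R) (Q : 'M[R]_m) X :
  multilinear F -> alternating F -> F (Q *m X) = \det Q * F X.
Proof.
move=> Fm Fa.
have FQm : multilinear (fun Q' : 'M[R]_m => F (Q' *m X)).
  move=> A B C s b c e1 e2 e3; apply: (Fm _ _ _ s).
  - by rewrite !row_mul e1 mulmxDl -!scalemxAl.
  - by rewrite !row'Esub -!mul_rowsub_mx -!row'Esub e2.
  - by rewrite !row'Esub -!mul_rowsub_mx -!row'Esub e3.
rewrite (multilinear_expand Q FQm).
rewrite (bigID (fun phi : {ffun 'I_m -> 'I_m} => injectiveb phi)) /=.
rewrite [X in _ + X]big1 ?addr0 => [|phi]; last first.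
  case/injectivePn => s [t st e]; rewrite (Fa _ s t) ?mulr0 //.
  by rewrite !row_mul; congr (_ *m _); apply/rowP => j; rewrite !mxE e.
rewrite (reindex (@pval _)) /=; last first.
  pose in_Sn := insubd (1%g : 'S_m).
  exists in_Sn => p Up; rewrite /= ?insubdK ?pvalK //.
  by apply: val_inj; rewrite insubdK.
rewrite /determinant mulr_suml; apply: eq_big => [p|p _].
  by rewrite (valP p).
rewrite -mulrA mulrCA -alternating_perm //.
have -> : \prod_i Q i (pval p i) = \prod_i Q i (p i).
  by apply: eq_bigr => s _; rewrite pvalE.
congr (_ * _); congr F; apply/row_matrixP => s.
apply/rowP => j; rewrite !mxE (bigD1 (p s)) //= mxE pvalE eqxx mul1r.
rewrite big1 ?addr0 // => l ls.
by rewrite mxE pvalE (negbTE ls) mul0r.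
Qed.

(* Moving the first vector to the place [s] costs [s] transpositions. *)
Lemma alternating_row' m n (F : 'M[R]_(m, n) -> R) (s : 'I_m) w X :
  multilinear F -> alternating F ->
  F (row' (lift ord0 s) (col_mx (w : 'rV_n) X : 'M[R]_(1 + m, n))) =
  (-1) ^+ s * F (set_row s w X).
Proof.
move=> Fm Fa; case: m s F X Fm Fa => [[]//|m] s F X Fm Fa.
set Y := row' _ _.
have -> : set_row s w X = row_perm (lift_perm s ord0 1) Y.
  apply/matrixP => r j; rewrite !mxE; case: (unliftP s r) => [t ->|->].
    rewrite eq_sym (negbTE (neq_lift _ _)) lift_perm_lift perm1.
    have -> : lift (lift ord0 s) (lift ord0 t) = rshift 1 (lift s t).
      by apply: val_inj; rewrite /= /bump /= !add1n ltnS addnS.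
    by rewrite (unsplitK (inr _)).
  rewrite eqxx lift_perm_id.
  have -> : lift (lift ord0 s) ord0 = lshift m.+1 (ord0 : 'I_1) by apply: val_inj.
  by rewrite (unsplitK (inl _)).
rewrite alternating_perm // odd_lift_perm odd_perm1 /= !addbF mulrA.
by rewrite -[in X in X * _ * _]signr_odd -signr_addb addbb mul1r.
Qed.

End Multilinear.

Section PositiveDefinite.
Variable R : rcfType.

Definition posdef m (P : 'M[R]_m) :=
  P^T = P /\ forall v : 'rV[R]_m, v != 0 -> 0 < (v *m P *m v^T) 0 0.

Lemma posdef_unit m (P : 'M[R]_m) : posdef P -> P \in unitmx.
Proof.
move=> [_ P0]; rewrite -row_free_unit -kermx_eq0; apply/eqP/row_matrixP => s.
rewrite row0; apply/eqP/negPn/negP => v0; have := P0 _ v0.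
by rewrite -row_mul mulmx_ker row0 mul0mx mxE ltxx.
Qed.

(** Completing the square, by induction on the size: [Q1] normalises the corner entry and clears its
    row and column. The determinant is kept positive so that it can be divided out of an inequality
    later. *)
Lemma posdef_congr1 m (P : 'M[R]_m) : posdef P ->
  exists2 Q : 'M[R]_m, 0 < \det Q & Q *m P *m Q^T = 1%:M.
Proof.
elim: m P => [|m IH] P [Ps Pp].
  by exists 1%:M; [rewrite det1 | apply/matrixP => -[]].
move: Ps Pp; rewrite -[m.+1]/(1 + m)%N in P * => Ps Pp.
pose p : R := P ord0 ord0; pose b := ursubmx P : 'rV_m.
have ulP : ulsubmx P = p%:M.
  by rewrite [LHS]mx11_scalar !mxE; congr (P _ _)%:M; apply: val_inj.
have dlP : dlsubmx P = b^T by rewrite /b trmx_ursub Ps.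
have PE : P = block_mx p%:M b b^T (drsubmx P).
  by rewrite -[LHS]submxK ulP dlP.
have p0 : 0 < p.
  have e0 : row_mx 1%:M 0 != 0 :> 'rV[R]_(1 + m).
    by rewrite row_mx_eq0 (negbTE (matrix_nonzero1 _ _)).
  have := Pp _ e0; rewrite PE tr_row_mx trmx0 tr_scalar_mx mul_row_block.
  by rewrite !mul0mx !addr0 !mul1mx mul_row_col mulmx1 mulmx0 addr0 mxE mulr1n.
pose r : R := (Num.sqrt p)^-1.
have r0 : 0 < r by rewrite invr_gt0 sqrtr_gt0.
(* The Schur complement of the corner entry; it is the restriction of the quadratic form [P] to a
   subspace, hence again positive definite. *)
pose S := drsubmx P - p^-1 *: (b^T *m b).
pose Q1 : 'M[R]_(1 + m) := block_mx r%:M 0 (- p^-1 *: b^T) 1%:M.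
have Q1P : Q1 *m P *m Q1^T = block_mx 1%:M 0 0 S.
  rewrite PE /Q1 tr_block_mx trmx0 !tr_scalar_mx linearZ /= trmxK !mulmx_block.
  rewrite !mul0mx !mulmx0 !mul1mx !mulmx1 !addr0.
  rewrite !mul_scalar_mx !mul_mx_scalar -!scalemxAl -!scalemxAr !scalerA.
  have pn0 : p != 0 by rewrite gt_eqF.
  rewrite (mulrN p) divff // !scaleN1r !addNr mul0mx !scaler0 add0r.
  rewrite mul_scalar_mx scalerA scale_scalar_mx mulrN mulNr mulfVK // scaleNr.
  rewrite addNr.
  rewrite -expr2 exprVn sqr_sqrtr ?ltW // mulVf //.
  by congr block_mx; rewrite addrC scaleNr.
have detQ1 : 0 < \det Q1 by rewrite det_lblock det1 mulr1 det_scalar1.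
have [|Q' dQ' Q'S] := IH S.
  split=> [|w w0].
    rewrite /S linearB /= linearZ /= trmx_mul trmxK; congr (_ - _).
    by rewrite -{2}Ps -trmx_drsub.
  have v0 : row_mx 0 w *m Q1 != 0.
    rewrite mul_row_block mul0mx mulmx1 add0r row_mx_eq0 negb_and.
    by rewrite mul0mx add0r w0 orbT.
  have := Pp _ v0; rewrite trmx_mul !mulmxA -(mulmxA _ Q1) -(mulmxA _ _ Q1^T).
  rewrite Q1P mul_row_block !mul0mx mulmx0 !add0r tr_row_mx mul_row_col.
  by rewrite mul0mx add0r.
exists (block_mx 1%:M 0 0 Q' *m Q1).
  by rewrite det_mulmx det_lblock det1 mul1r mulr_gt0.
rewrite trmx_mul !mulmxA -(mulmxA _ Q1) -(mulmxA _ _ Q1^T) Q1P.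
rewrite tr_block_mx !trmx0 trmx1 !mulmx_block.
rewrite !(mul0mx, mulmx0, mul1mx, mulmx1, addr0, add0r) Q'S.
by rewrite [RHS]scalar_mx_block.
Qed.

(** An invertible Gram matrix forces the rows of [A] to be independent, so positivity of [H] passes
    to their span. *)
Lemma posdef_restrict m n (H : 'M[R]_n) (A : 'M[R]_(m, n)) :
  posdef H -> A *m H *m A^T \in unitmx -> posdef (A *m H *m A^T).
Proof.
move=> [Hs Hp] uP; split=> [|v v0].
  by rewrite !trmx_mul trmxK Hs mulmxA.
have vA : v *m A != 0.
  apply: contra v0 => /eqP vA.
  by rewrite -[v](mulmxK uP) !mulmxA vA !mul0mx.
by have := Hp _ vA; rewrite trmx_mul !mulmxA.
Qed.

Lemma posdef_det_gt0 m (P : 'M[R]_m) : posdef P -> 0 < \det P.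
Proof.
move=> /posdef_congr1[Q dQ /(congr1 determinant)].
rewrite det_mulmx det_mulmx det_tr det1 mulrAC => QP.
by rewrite -(pmulr_rgt0 _ (mulr_gt0 dQ dQ)) QP.
Qed.

(** The diagonal of the Gram matrix holds the squared lengths of the rows of [A]. *)
Lemma posdef_isotropic m n (P : 'M[R]_n) (A : 'M[R]_(m, n)) :
  posdef P -> A *m P *m A^T = 0 -> A = 0.
Proof.
move=> [_ Pp] A0; apply/row_matrixP => s; rewrite row0; apply/eqP.
apply/negPn/negP => /Pp; rewrite -row_mul tr_row.
have -> : (row s (A *m P) *m col s A^T) 0 0 = (A *m P *m A^T) s s.
  by rewrite !mxE; apply: eq_bigr => j _; rewrite !mxE.
by rewrite A0 mxE ltxx.
Qed.

(** Some [Q] of positive determinant makes [Q *m A] orthonormal. The form then scales by [\det Q],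
    which is the inverse of the square root of the Gram determinant. *)
Lemma comass_le1_bound m n (F : 'M[R]_(m, n) -> R) (H : 'M[R]_n)
    (A : 'M[R]_(m, n)) :
  multilinear F -> alternating F -> posdef H ->
  (forall E, E *m H *m E^T = 1%:M -> F E <= 1) ->
  A *m H *m A^T \in unitmx -> F A <= Num.sqrt (\det (A *m H *m A^T)).
Proof.
move=> Fm Fa Hp F1 uP.
have [Q dQ QP] := posdef_congr1 (posdef_restrict Hp uP).
have := F1 (Q *m A); rewrite trmx_mul !mulmxA -2!(mulmxA Q) QP => /(_ erefl).
rewrite alternating_mulmx // mulrC -ler_pdivlMr // mul1r => /le_trans; apply.
have : \det Q ^+ 2 * \det (A *m H *m A^T) = 1.
  have := congr1 determinant QP.
  by rewrite det_mulmx det_mulmx det_tr det1 mulrAC -expr2.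
move=> /(canRL (mulKf (lt0r_neq0 (exprn_gt0 2 dQ)))) ->.
by rewrite mulr1 -exprVn sqrtr_sqr ger0_norm // invr_ge0 ltW.
Qed.

End PositiveDefinite.

Lemma mxtrace_mul_delta (R : comNzRingType) m n (N : 'M[R]_(m, n)) s b :
  \tr (N *m (delta_mx s b)^T) = N s b.
Proof.
rewrite trmx_delta /mxtrace (bigD1 s) //= big1 ?addr0 => [|t ts]; last first.
  by rewrite mxE big1 // => j _; rewrite mxE (negbTE ts) andbF mulr0.
rewrite mxE (bigD1 b) //= mxE !eqxx mulr1 big1 ?addr0 // => j jb.
by rewrite mxE (negbTE jb) mulr0.
Qed.

(** * Differentiation *)

Lemma derive_comp (R : realType) (U V W : normedModType R) (f : U -> V)
    (g : V -> W) (x v : U) :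
  differentiable f x -> differentiable g (f x) ->
  'D_v (fun y => g (f y)) x = 'D_('D_v f x) g (f x).
Proof.
move=> df dg; rewrite !deriveE //; first by rewrite diff_comp.
exact: differentiable_comp.
Qed.

Section DifferentiationRules.
Variables (R : realType) (V : normedModType R).
Implicit Types (x v : V).

(** Chart expressions satisfy their identities only on an open set, so differentiability must pass
    between functions that agree merely near [x]. *)
Lemma near_eq_differentiable (W : normedModType R) (f g : V -> W) x :
  (\forall y \near x, f y = g y) -> differentiable f x -> differentiable g x.
Proof.
move=> fg df.
have E : g \o shift x = cst (g x) + 'd f x +o_ 0 id.
  have [dc /eqaddoP fE] := (diff_locallyP x f).1 df.
  apply/eqaddoP => e e0; have := fE e e0.
  have sh : \forall y \near 0, f (shift x y) = g (shift x y).
    by have := fg; rewrite (near_shift 0) subr0.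
  move: sh; apply: filterS2 => y fgy /=.
  by rewrite !fctE /= in fgy *; rewrite fgy (nbhs_singleton fg).
have dE := diff_unique (diff_continuous df) E.
by apply/diff_locallyP; rewrite dE; split => //; exact: diff_continuous.
Qed.

Lemma differentiable_mul (f g : V -> R) x : differentiable f x ->
  differentiable g x -> differentiable (fun y => f y * g y) x.
Proof. exact: differentiableM. Qed.

Lemma derive_mul (f g : V -> R) x v : differentiable f x ->
  differentiable g x ->
  'D_v (fun y => f y * g y) x = f x * 'D_v g x + g x * 'D_v f x.
Proof.
by move=> df dg; rewrite (deriveM (diff_derivable df) (diff_derivable dg)).
Qed.

Lemma differentiable_bigsum (W : normedModType R) (I : Type) (r : seq I)
    (P : pred I) (F : I -> V -> W) x : (forall i, differentiable (F i) x) ->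
  differentiable (fun y => \sum_(i <- r | P i) F i y) x.
Proof.
move=> dF; rewrite (_ : (fun y => _) = \sum_(i <- r | P i) F i); last first.
  by apply/funext => y; rewrite fct_sumE.
elim/big_ind: _ => [|f g df dg|//]; first exact: differentiable_cst.
exact: differentiableD.
Qed.

Lemma derive_bigsum (W : normedModType R) (I : Type) (r : seq I)
    (P : pred I) (F : I -> V -> W) x v : (forall i, differentiable (F i) x) ->
  'D_v (fun y => \sum_(i <- r | P i) F i y) x = \sum_(i <- r | P i) 'D_v (F i) x.
Proof.
move=> dF; elim: r => [|i r IH].
  rewrite big_nil -[RHS](derive_cst (0 : W) x v); congr ('D_v _ x).
  by apply/funext => y; rewrite big_nil.
rewrite big_cons -IH; case: ifPn => Pi; last first.
  by congr ('D_v _ x); apply/funext => y; rewrite big_cons (negbTE Pi).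
rewrite -deriveD; [|exact: diff_derivable|]; last first.
  by apply: diff_derivable; exact: differentiable_bigsum.
by congr ('D_v _ x); apply/funext => y; rewrite big_cons Pi.
Qed.

Lemma differentiable_bigprod (I : Type) (r : seq I) (P : pred I)
    (F : I -> V -> R) x : (forall i, differentiable (F i) x) ->
  differentiable (fun y => \prod_(i <- r | P i) F i y) x.
Proof.
move=> dF; elim: r => [|i r IH].
  rewrite (_ : (fun y => _) = cst 1) //.
  by apply/funext => y; rewrite big_nil.
case Pi : (P i); last first.
  by under eq_fun do rewrite big_cons Pi.
by under eq_fun do rewrite big_cons Pi; exact: differentiable_mul.
Qed.

Lemma derive_bigprod (I : finType) (F : I -> V -> R) x v :
  (forall i, differentiable (F i) x) ->
  'D_v (fun y => \prod_i F i y) x =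
  \sum_i 'D_v (F i) x * \prod_(j | j != i) F j x.
Proof.
move=> dF; have := index_enum_uniq I; elim: (index_enum I) => [_|i r IH].
  rewrite big_nil -[RHS](derive_cst (1 : R) x v); congr ('D_v _ x).
  by apply/funext => y; rewrite big_nil.
move=> /= /andP[ir ur]; under eq_fun do rewrite big_cons.
rewrite derive_mul //; last exact: differentiable_bigprod.
rewrite IH // big_cons big_cons eqxx addrC mulrC; congr (_ * _ + _).
  rewrite big_seq [RHS]big_seq_cond; apply: eq_bigl => j.
  case: (boolP (j \in r)) => //= jr; apply/esym; apply: contraNneq ir => <-.
  by [].
rewrite mulr_sumr big_seq [RHS]big_seq; apply: eq_bigr => j jr.
rewrite big_cons mulrCA; case: eqVneq => // ij.
by rewrite ij jr in ir.
Qed.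

Lemma differentiable_mxP m n (M : V -> 'M[R]_(m, n)) x :
  differentiable M x <-> forall i j, differentiable (fun y => M y i j) x.
Proof.
split=> [dM i j|dM].
  exact: (differentiable_comp dM (differentiable_coord _ i j)).
rewrite (_ : M = fun y => \sum_i \sum_j M y i j *: delta_mx i j); last first.
  by apply/funext => y; exact: matrix_sum_delta.
do 2!apply: differentiable_bigsum => ?.
exact: differentiableZl.
Qed.

Lemma derive_mxE m n (M : V -> 'M[R]_(m, n)) x v i j : differentiable M x ->
  ('D_v M x) i j = 'D_v (fun y => M y i j) x.
Proof. by move=> dM; rewrite derive_mx ?mxE //; exact: diff_derivable. Qed.

Lemma differentiable_mulmx m n p (A : V -> 'M[R]_(m, n)) (B : V -> 'M[R]_(n, p)) x :
  differentiable A x -> differentiable B x ->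
  differentiable (fun y => A y *m B y) x.
Proof.
move=> /differentiable_mxP dA /differentiable_mxP dB.
apply/differentiable_mxP => i j; under eq_fun do rewrite mxE.
by apply: differentiable_bigsum => k; exact: differentiable_mul.
Qed.

Lemma derive_mulmx m n p (A : V -> 'M[R]_(m, n)) (B : V -> 'M[R]_(n, p)) x v :
  differentiable A x -> differentiable B x ->
  'D_v (fun y => A y *m B y) x = 'D_v A x *m B x + A x *m 'D_v B x.
Proof.
move=> dA dB; have dA' := (differentiable_mxP _ _).1 dA.
have dB' := (differentiable_mxP _ _).1 dB.
apply/matrixP => i j; rewrite derive_mxE; last exact: differentiable_mulmx.
under eq_fun do rewrite mxE.
rewrite derive_bigsum => [|k]; last exact: differentiable_mul.
rewrite !mxE -big_split; apply: eq_bigr => k _.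
by rewrite derive_mul // !derive_mxE // addrC [B x k j * _]mulrC.
Qed.

Lemma differentiable_scale m n (c : V -> R) (A : V -> 'M[R]_(m, n)) x :
  differentiable c x -> differentiable A x ->
  differentiable (fun y => c y *: A y) x.
Proof.
move=> dc /differentiable_mxP dA.
apply/differentiable_mxP => i j; under eq_fun do rewrite mxE.
exact: differentiable_mul.
Qed.

Section MultilinearFamily.
Variables (m n : nat) (F : V -> 'M[R]_(m, n) -> R) (x : V).
Hypothesis Fm : \forall y \near x, multilinear (F y).
Hypothesis dF : forall Z, differentiable (F^~ Z) x.

Let expand (X : V -> 'M[R]_(m, n)) y :=
  \sum_(phi : {ffun 'I_m -> 'I_n})
     (\prod_s X y s (phi s)) * F y (select_mx R phi).

Let expandE X : \forall y \near x, expand X y = F y (X y).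
Proof. by apply: filterS Fm => y Fy; apply/esym/multilinear_expand. Qed.

Lemma differentiable_multilinear (X : V -> 'M[R]_(m, n)) :
  differentiable X x -> differentiable (fun y => F y (X y)) x.
Proof.
move=> /differentiable_mxP dX; apply: near_eq_differentiable (expandE X) _.
apply: differentiable_bigsum => phi; apply: differentiable_mul => //.
exact: differentiable_bigprod.
Qed.

(** Leibniz rule on the finite expansion: differentiating the coefficients freezes [X], and
    differentiating the products of entries replaces one row of [X] at a time. Multilinearity is
    asked near [x] only, as the components of a form have it over the chart domain. *)
Lemma derive_multilinear (X : V -> 'M[R]_(m, n)) v : differentiable X x ->
  'D_v (fun y => F y (X y)) x = 'D_v (F^~ (X x)) x
    + \sum_s F x (set_row s (row s ('D_v X x)) (X x)).
Proof.
move=> dX'; have dX := (differentiable_mxP _ _).1 dX'.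
have dP phi : differentiable (fun y => \prod_s X y s (phi s)) x.
  by apply: differentiable_bigprod.
have Fxm := nbhs_singleton Fm.
rewrite -(near_eq_derive _ (expandE X)).
rewrite -(near_eq_derive _ (expandE (fun=> X x))) /expand.
rewrite !derive_bigsum => [|phi|phi]; try exact: differentiable_mul.
under [X in _ = _ + X]eq_bigr => s _ do rewrite (multilinear_expand _ Fxm).
rewrite exchange_big -big_split; apply: eq_bigr => phi _ /=.
rewrite !derive_mul // derive_cst mulr0 addr0; congr (_ + _).
rewrite derive_bigprod // mulrC mulr_suml; apply: eq_bigr => s _.
rewrite [in RHS](bigD1 s) //= !mxE eqxx derive_mxE //; congr (_ * _ * _).
by apply: eq_bigr => t ts; rewrite !mxE (negbTE ts).
Qed.

End MultilinearFamily.

Lemma differentiable_det n (M : V -> 'M[R]_n) x : differentiable M x ->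
  differentiable (fun y => \det (M y)) x.
Proof.
move=> dM; apply: (@differentiable_multilinear _ _ (fun=> @determinant R n)) => //.
by near=> y; exact: det_multilinear.
Unshelve. all: by end_near. Qed.

(** Jacobi's formula: the determinant with row [s] replaced by its derivative is expanded along that
    row into cofactors. *)
Lemma derive_det n (M : V -> 'M[R]_n) x v : differentiable M x ->
  'D_v (fun y => \det (M y)) x = \tr ('D_v M x *m \adj (M x)).
Proof.
move=> dM; rewrite (@derive_multilinear _ _ (fun=> @determinant R n)) //.
  rewrite derive_cst add0r; apply: eq_bigr => s _.
  rewrite (expand_det_row _ s) [RHS]mxE; apply: eq_bigr => j _.
  rewrite !mxE eqxx; congr (_ * (_ * \det _)); apply/matrixP => r l.
  by rewrite !mxE eq_sym (negbTE (neq_lift _ _)).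
by near=> y; exact: det_multilinear.
Unshelve. all: by end_near. Qed.

Lemma derive_det_unit n (M : V -> 'M[R]_n) x v : differentiable M x ->
  M x \in unitmx ->
  'D_v (fun y => \det (M y)) x = \det (M x) * \tr (invmx (M x) *m 'D_v M x).
Proof.
move=> dM uM; rewrite derive_det // mxtrace_mulC /invmx uM -scalemxAl.
by rewrite mxtraceZ mulrA divff ?mul1r // -unitfE -unitmxE.
Qed.

(** Near [x] the determinant stays nonzero, and Cramer's rule writes the inverse as the adjugate
    over the determinant. *)
Lemma differentiable_invmx n (M : V -> 'M[R]_n) x : differentiable M x ->
  M x \in unitmx -> differentiable (fun y => invmx (M y)) x.
Proof.
move=> dM uM; have dd := differentiable_det dM.
have d0 : \det (M x) != 0 by rewrite -unitfE -unitmxE.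
have near0 : \forall y \near x, \det (M y) != 0.
  by apply: (cvgr_neq0 _ (differentiable_continuous dd) d0).
apply: (@near_eq_differentiable _ (fun y => (\det (M y))^-1 *: \adj (M y))).
  by apply: filterS near0 => y y0; rewrite /invmx unitmxE unitfE y0.
apply: differentiable_scale; first exact: (differentiableV dd).
apply/differentiable_mxP => i j; under eq_fun do rewrite mxE.
apply: differentiable_mul => //; apply: differentiable_det.
apply/differentiable_mxP => s t; under eq_fun do rewrite !mxE.
by move/differentiable_mxP : dM; apply.
Qed.

Lemma differentiable_sqrt (f : V -> R) x : differentiable f x -> 0 < f x ->
  differentiable (fun y => Num.sqrt (f y)) x.
Proof.
move=> df f0; apply: (differentiable_comp df).
by apply/derivable1_diffP; have [] := is_derive1_sqrt f0.
Qed.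

Lemma derive_sqrt_comp (f : V -> R) x v : differentiable f x -> 0 < f x ->
  'D_v (fun y => Num.sqrt (f y)) x = (2 * Num.sqrt (f x))^-1 * 'D_v f x.
Proof.
move=> df f0; have ds : differentiable (@Num.sqrt R) (f x).
  by apply/derivable1_diffP; have [] := is_derive1_sqrt f0.
rewrite (derive_comp v df ds); set w := 'D_v f x.
rewrite (deriveE _ ds) -[X in 'd _ _ X]mulr1 [LHS]linearZ /=.
by rewrite -(deriveE _ ds) derive_sqrt // [LHS]mulrC.
Qed.

Lemma differentiable_trmx m n (M : V -> 'M[R]_(m, n)) x :
  differentiable M x -> differentiable (fun y => (M y)^T) x.
Proof.
move=> /differentiable_mxP dM; apply/differentiable_mxP => i j.
by under eq_fun do rewrite mxE.
Qed.

Lemma derive_trmx m n (M : V -> 'M[R]_(m, n)) x v :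
  differentiable M x -> 'D_v (fun y => (M y)^T) x = ('D_v M x)^T.
Proof.
move=> dM; apply/matrixP => i j.
rewrite [RHS]mxE !derive_mxE //; last exact: differentiable_trmx.
by under eq_fun do rewrite mxE.
Qed.

Lemma differentiable_line (v y : V) (s : R) :
  differentiable (fun r : R => r *: v + y) s.
Proof.
have dz : differentiable ( *:%R^~ v : R -> V) s by [].
exact: (differentiableD dz).
Qed.

Lemma derive_line (v y : V) (s : R) : 'D_1 (fun r : R => r *: v + y) s = v.
Proof.
have dz : differentiable ( *:%R^~ v : R -> V) s by [].
rewrite [LHS](deriveD (diff_derivable dz)); last exact: derivable_cst.
by rewrite derive_cst addr0 (deriveE _ dz) diff_val scale1r.
Qed.

End DifferentiationRules.

Lemma derive_lin (R : realType) n m m' (F : 'rV[R]_n -> 'M[R]_(m, m')) x v :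
  differentiable F x ->
  'D_v F x = \sum_a v 0 a *: 'D_(delta_mx 0 a) F x.
Proof.
move=> dF; rewrite (deriveE _ dF) {1}(row_sum_delta v) linear_sum.
by apply: eq_bigr => a _; rewrite linearZ (deriveE _ dF).
Qed.

(** The difference [f - g] has a local maximum at [x]. This is the step by which an inequality with
    a case of equality yields an identity between first derivatives. *)
Lemma derive_le_touch (R : realType) (f g : R -> R) (x : R) :
  derivable f x 1 -> derivable g x 1 ->
  (\forall y \near x, f y <= g y) -> f x = g x -> 'D_1 f x = 'D_1 g x.
Proof.
move=> df dg fg fgx; apply/eqP; rewrite -subr_eq0 -normr_le0.
apply/ler_addgt0Pl => e e0; rewrite addr0 -deriveB //.
have /derivable_nbhs/eqaddoP/(_ e e0) dfg := derivableB df dg.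
have sh : \forall y \near 0, f (y + x) <= g (y + x).
  by have := fg; rewrite (near_shift 0) subr0.
have [d /= d0 H] := filterI sh dfg.
have b y : `|y| < d -> f (y + x) - g (y + x) <= 0 /\
    `|f (y + x) - g (y + x) - y * 'D_1 (f - g) x| <= e * `|y|.
  move=> yd; have /= := H y; rewrite sub0r normrN => /(_ yd) [].
  by rewrite subr_le0 !fctE /= !scaler1 fgx subrr add0r.
(* The displacements [d / 2] and [- (d / 2)] lie within the radius [d] and give the upper and the
   lower bound on the derivative respectively. *)
have t0 : 0 < d / 2 by rewrite divr_gt0.
have nt : `|d / 2| = d / 2 by rewrite gtr0_norm.
have td : d / 2 < d by lra.
have [b1 b2] : _ /\ _ := b (d / 2) ltac:(by rewrite nt).
have [b3 b4] : _ /\ _ := b (- (d / 2)) ltac:(by rewrite normrN nt).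
rewrite normrN in b4; rewrite nt in b2 b4.
move: b2 b4; rewrite !ler_norml => /andP[b2 _] /andP[b4 _].
by apply/andP; split; rewrite -(ler_pM2l t0); lra.
Qed.

(** * Symmetry of second derivatives, for first derivatives that are differentiable at the point *)

Section Schwarz.
Variables (R : realType) (V : normedModType R) (f : V -> R) (x : V).
Hypothesis df : \forall y \near x, differentiable f y.

Lemma is_derive_line (v y : V) (s : R) : differentiable f (s *: v + y) ->
  is_derive s 1 (fun r => f (r *: v + y)) ('D_v f (s *: v + y)).
Proof.
move=> dfs; have dl := differentiable_line v y s; split.
  by apply: diff_derivable; exact: (differentiable_comp dl dfs).
by rewrite (derive_comp _ dl dfs) derive_line.
Qed.

(** The mean value theorem in the direction [v] turns the second difference into [t] times an
    increment of the derivative along [v]; the first order expansion of that derivative at [x], used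
    at both ends of the increment, gives the second derivative. *)
Lemma second_difference v w (e : R) : 0 < e ->
  differentiable (fun y => 'D_v f y) x ->
  \forall t \near (0 : R)^'+,
  `|f (t *: v + t *: w + x) - f (t *: v + x) - f (t *: w + x) + f x
    - t ^+ 2 * 'D_w (fun y => 'D_v f y) x| <= e * t ^+ 2.
Proof.
move=> e0 ddf.
(* The two expansion errors are taken at points whose norms add up to at most [t * (2 * |v| + |w|)];
   the summand 1 only makes [C] positive. *)
pose C := 2 * `|v| + `|w| + 1.
have C0 : 0 < C by rewrite ltr_wpDl // addr_ge0 // mulr_ge0.
have e'0 : 0 < e / C by rewrite divr_gt0.
have [_ /eqaddoP/(_ _ e'0) dg] := (diff_locallyP x _).1 ddf.
have sh : \forall y \near 0, differentiable f (y + x).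
  by have := df; rewrite (near_shift 0) subr0.
have [d /= d0 H] := nbhs_norm0P.1 (filterI sh dg).
set g := fun y => 'D_v f y in H ddf dg *.
have {}H y : `|y| < d -> differentiable f (y + x) /\
    `|g (y + x) - g x - 'd g x y| <= e / C * `|y|.
  by move=> /H[? /=]; rewrite !fctE /= opprD addrA.
have dC : 0 < d / C by rewrite divr_gt0.
apply: filterS2 (nbhs_right_gt (0 : R)) (nbhs_right_lt dC) => t t0.
rewrite ltr_pdivlMr // => tC.
(* The boolean treats the points with and without the shift by [t *: w] together. *)
have small (s : R) (b : bool) : 0 <= s <= t ->
    `|s *: v + (if b then t else 0) *: w| <= t * (`|v| + `|w|).
  case/andP => s0 st; rewrite (le_trans (ler_normD _ _)) // mulrDr !normrZ.
  rewrite lerD // ler_wpM2r // ger0_norm //; first by case: b => //; exact: ltW.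
  by case: b => //; exact: ltW.
have smalld (s : R) (b : bool) : 0 <= s <= t ->
    `|s *: v + (if b then t else 0) *: w| < d.
  move=> /(small s b) /le_lt_trans; apply; apply: le_lt_trans tC.
  by rewrite ler_pM2l // /C; have := normr_ge0 v; lra.
pose G s := f (s *: v + t *: w + x) - f (s *: v + x).
have dG s : 0 <= s <= t ->
    is_derive s 1 G (g (s *: v + t *: w + x) - g (s *: v + x)).
  move=> st; apply: is_deriveB.
    have := is_derive_line (v := v) (y := t *: w + x) (s := s).
    rewrite addrA => /(_ (H _ (smalld s true st)).1).
    by under eq_fun do rewrite addrA.
  apply: is_derive_line; have := (H _ (smalld s false st)).1.
  by rewrite scale0r addr0.
have [||] := @MVT R G (fun s => g (s *: v + t *: w + x) - g (s *: v + x)) 0 t t0.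
- move=> s; rewrite in_itv /= => /andP[/ltW s0 /ltW st].
  by apply: dG; rewrite s0.
- by apply: derivable_within_continuous => s; rewrite in_itv /= => /dG[].
move=> s; rewrite in_itv /= => /andP[/ltW s0 /ltW st]; rewrite subr0 /G.
rewrite !scale0r !add0r => E.
have sI : 0 <= s <= t by rewrite s0.
have b1 := (H _ (smalld s true sI)).2; have b2 := (H _ (smalld s false sI)).2.
have c1 := small s true sI; have c2 : `|s *: v| <= t * `|v|.
  by rewrite normrZ ger0_norm // ler_wpM2r.
rewrite /= scale0r addr0 in b2; rewrite /= linearD in b1.
rewrite linearZ /= [X in _ - (_ + X)]linearZ /= in b1.
rewrite [X in _ - X]linearZ /= in b2.
rewrite (deriveE _ ddf).
move: (g (s *: v + t *: w + x)) (g (s *: v + x)) (g x) ('d g x v) ('d g x w)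
  b1 b2 E => A B D p q b1 b2 E.
have -> : f (t *: v + t *: w + x) - f (t *: v + x) - f (t *: w + x) + f x =
    (A - B) * t by rewrite -E opprB [in RHS]addrA addrAC.
have -> : (A - B) * t - t ^+ 2 * q = (A - B - t * q) * t by ring.
rewrite normrM (gtr0_norm t0) expr2 mulrA ler_pM2r //.
have k : e / C * `|s *: v + t *: w| + e / C * `|s *: v| <= e * t.
  have -> : e * t = e / C * (C * t) by rewrite mulrA mulfVK // lt0r_neq0.
  by rewrite -mulrDr ler_pM2l // /C; move: c1 c2; rewrite /=; lra.
have -> : A - B - t * q = (A - D - (s * p + t * q)) - (B - D - s * p) by ring.
by rewrite (le_trans (ler_normB _ _)) // (le_trans _ k) // lerD.
Qed.

(** The second difference is symmetric in [v] and [w], so both iterated derivatives approximate it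
    up to [e / 2 * t ^+ 2]. *)
Lemma derive_sym v w :
  differentiable (fun y => 'D_v f y) x -> differentiable (fun y => 'D_w f y) x ->
  'D_w (fun y => 'D_v f y) x = 'D_v (fun y => 'D_w f y) x.
Proof.
move=> dv dw; apply/eqP; rewrite -subr_eq0 -normr_le0.
apply/ler_addgt0Pl => e e0; rewrite addr0.
have e2 : 0 < e / 2 by rewrite divr_gt0.
have Hv := second_difference w e2 dv; have Hw := second_difference v e2 dw.
have [t [[]]] := filter_ex (filterI (filterI Hv Hw) (nbhs_right_gt 0)).
move=> + + /= t_gt0; have t0 : 0 < t ^+ 2 by rewrite exprn_gt0.
have -> : t *: w + t *: v = t *: v + t *: w by exact: addrC.
move: ('D_w _ x) ('D_v (fun y => 'D_w f y) x) => D1 D2.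
rewrite !ler_norml => /andP[b1 b2] /andP[b3 b4].
by apply/andP; split; rewrite -(ler_pM2l t0); lra.
Qed.

End Schwarz.

(** * Smith immersions in coordinates *)

Section SmithChart.
Variables (R : realType) (k n : nat).
Variables (U : set 'rV[R]_k) (V : set 'rV[R]_n) (f : 'rV[R]_k -> 'rV[R]_n).
Variables (G : 'rV[R]_k -> 'M[R]_k) (H : 'rV[R]_n -> 'M[R]_n).
Variable (a : 'rV[R]_n -> 'M[R]_(k, n) -> R).
Hypothesis k_ge2 : (2 <= k)%N.
Hypotheses (U_open : open U) (V_open : open V).
Hypothesis fUV : forall x, U x -> V (f x).
Hypothesis f_diff : forall x, U x -> differentiable f x.
Hypothesis f_diff2 : forall v x, U x -> differentiable (fun y => 'D_v f y) x.
Hypothesis G_diff : forall x, U x -> differentiable G x.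
Hypothesis G_posdef : forall x, U x -> posdef (G x).
Hypothesis H_diff : forall y, V y -> differentiable H y.
Hypothesis H_posdef : forall y, V y -> posdef (H y).
Hypothesis a_multilinear : forall y, V y -> multilinear (a y).
Hypothesis a_alternating : forall y, V y -> alternating (a y).
Hypothesis a_diff : forall X y, V y -> differentiable (a^~ X) y.
Hypothesis a_closed : forall y, V y -> forall X : 'M[R]_(k.+1, n),
  \sum_(s < k.+1) (-1) ^+ s * 'D_(row s X) (fun z => a z (row' s X)) y = 0.
Hypothesis a_calibration : forall y, V y -> forall E,
  E *m H y *m E^T = 1%:M -> a y E <= 1.

Definition chart_norm2 x :=
  \tr (invmx (G x) *m ('J f x *m H (f x) *m ('J f x)^T)).
Local Notation nu x := (Num.sqrt (chart_norm2 x)).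

Hypothesis f_conformal : forall x, U x ->
  'J f x *m H (f x) *m ('J f x)^T = (k%:R^-1 * chart_norm2 x) *: G x.
Hypothesis f_calibrated : forall x, U x ->
  a (f x) ('J f x) =
  (Num.sqrt k%:R ^+ k)^-1 * nu x ^+ k * Num.sqrt (\det (G x)).

Implicit Types (x : 'rV[R]_k) (y : 'rV[R]_n).

Let nearU x : U x -> \forall z \near x, U z.
Proof. by move=> Ux; apply: open_nbhs_nbhs. Qed.

Let nearV y : V y -> \forall z \near y, V z.
Proof. by move=> Vy; apply: open_nbhs_nbhs. Qed.

Let a_near x : U x -> \forall z \near x, multilinear (a (f z)).
Proof. by move=> Ux; apply: filterS (nearU Ux) => z /fUV/a_multilinear. Qed.

(** With [l = |du|^2 / k], the power [Num.sqrt l ^+ (k - 2)] is [c] times [|du|^(k-2)]. *)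
Let c : R := (Num.sqrt k%:R)^-1 ^+ (k - 2).

Let k_gt0 : 0 < k%:R :> R.
Proof. by rewrite ltr0n (leq_trans _ k_ge2). Qed.

Let c_gt0 : 0 < c.
Proof. by rewrite exprn_gt0 // invr_gt0 sqrtr_gt0. Qed.

(** The conformality equation evaluated on one coordinate vector: the pulled back metric is
    nonnegative there and [G] is positive. *)
Lemma chart_norm2_ge0 x : U x -> 0 <= chart_norm2 x.
Proof.
move=> Ux; pose s : 'I_k := Ordinal (leq_trans (isT : (0 < 2)%N) k_ge2).
have e0 : delta_mx 0 s != 0 :> 'rV[R]_k.
  by apply/eqP => /rowP/(_ s)/eqP; rewrite !mxE !eqxx oner_eq0.
have Ge := (G_posdef Ux).2 _ e0.
pose e : 'rV[R]_k := delta_mx 0 s.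
have : 0 <= (e *m ((k%:R^-1 * chart_norm2 x) *: G x) *m e^T) 0 0.
  rewrite -f_conformal // !mulmxA -mulmxA -trmx_mul.
  have [->|v0] := eqVneq (e *m 'J f x) 0.
    by rewrite !mul0mx mxE.
  exact/ltW/(H_posdef (fUV Ux)).2.
rewrite -scalemxAr -scalemxAl mxE pmulr_lge0 // pmulr_rge0 // invr_gt0 //.
Qed.

Lemma chart_norm_eq0 x : U x -> chart_norm2 x = 0 -> 'J f x = 0.
Proof.
move=> Ux n0; apply: (posdef_isotropic (H_posdef (fUV Ux))).
by rewrite f_conformal // n0 mulr0 scale0r.
Qed.

(** Here [phi] is the value of the form along a curve of pairs (base point, family of vectors) and
    [Q] is the Gram matrix along it. The calibration inequality is an equality at time 0, so the
    derivatives agree, and that of the right side follows from Jacobi's formula. The square root is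
    differentiable because the Gram determinant is positive where [|du|] is nonzero. *)
Lemma first_variation x (phi : R -> R) (Q : R -> 'M[R]_k) : U x ->
  chart_norm2 x != 0 -> differentiable phi 0 -> differentiable Q 0 ->
  phi 0 = a (f x) ('J f x) -> Q 0 = 'J f x *m H (f x) *m ('J f x)^T ->
  (\forall t \near 0, Q t \in unitmx -> phi t <= Num.sqrt (\det (Q t))) ->
  'D_1 phi 0 = 2^-1 * (c * nu x ^+ (k - 2) * Num.sqrt (\det (G x)))
               * \tr (invmx (G x) *m 'D_1 Q 0).
Proof.
move=> Ux nu0 dphi dQ phi0 Q0 phiQ.
have nu_gt0 : 0 < chart_norm2 x by rewrite lt_def nu0 chart_norm2_ge0.
pose l : R := k%:R^-1 * chart_norm2 x.
have l0 : 0 < l by rewrite mulr_gt0 // invr_gt0.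
have Gd := posdef_det_gt0 (G_posdef Ux).
rewrite f_conformal // -/l in Q0.
have detQ : \det (Q 0) = l ^+ k * \det (G x) by rewrite Q0 detZ.
have detQ0 : 0 < \det (Q 0) by rewrite detQ mulr_gt0 // exprn_gt0.
have Qu : Q 0 \in unitmx by rewrite unitmxE unitfE gt_eqF.
have sl : Num.sqrt l = (Num.sqrt k%:R)^-1 * nu x.
  by rewrite sqrtrM ?invr_ge0 ?ltW // sqrtrV // ltW.
have sdet : Num.sqrt (\det (Q 0)) = Num.sqrt l ^+ k * Num.sqrt (\det (G x)).
  rewrite detQ sqrtrM; last by rewrite exprn_ge0 // ltW.
  congr (_ * _); rewrite -[in LHS](sqr_sqrtr (ltW l0)) exprAC sqrtr_sqr.
  by rewrite ger0_norm // exprn_ge0.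
have ddet := differentiable_det dQ.
rewrite (@derive_le_touch _ phi (fun t => Num.sqrt (\det (Q t)))).
- rewrite derive_sqrt_comp // derive_det_unit // sdet detQ Q0 invmxZ; last first.
    by rewrite -Q0.
  rewrite -scalemxAl mxtraceZ.
  (* Splitting [k] as [(k - 2) + 2] isolates a factor [l], which cancels the inverse of [l] coming
     from [invmx (l *: G x)]. *)
  have lk : Num.sqrt l ^+ k = c * nu x ^+ (k - 2) * l.
    by rewrite -{2}(sqr_sqrtr (ltW l0)) /c -exprMn -sl -exprD subnK.
  have -> : l ^+ k = (Num.sqrt l ^+ k) ^+ 2.
    by rewrite exprAC sqr_sqrtr // ltW.
  rewrite lk; set r := Num.sqrt (\det (G x)).
  have -> : \det (G x) = r ^+ 2 by rewrite sqr_sqrtr // ltW.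
  field.
  by rewrite !gt_eqF // ?sqrtr_gt0 // exprn_gt0 ?sqrtr_gt0.
- exact: diff_derivable.
- exact/diff_derivable/differentiable_sqrt.
(* The inequality is assumed for invertible [Q t] only; continuity of the determinant supplies this
   near 0. *)
- have near0 : \forall t \near 0, \det (Q t) != 0.
    by apply: (cvgr_neq0 _ (differentiable_continuous ddet) (lt0r_neq0 detQ0)).
  apply: filterS2 phiQ near0 => t tQ t0; apply: tQ.
  by rewrite unitmxE unitfE.
- rewrite phi0 f_calibrated // sdet sl exprMn exprVn //.
Qed.

(* Row [s], up to the sign [(-1) ^+ s], lists the components of the forms
   [u^* (i_b alpha)] with the [s]-th coordinate vector omitted. *)
Definition polarization x : 'M[R]_(k, n) :=
  \matrix_(s, b) a (f x) (set_row s (delta_mx 0 b) ('J f x)).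

(** First variation in the family of vectors: one entry of the Jacobian moves while the base point
    stays fixed. *)
Lemma polarizationE x : U x -> polarization x =
  (c * nu x ^+ (k - 2) * Num.sqrt (\det (G x))) *:
    (invmx (G x) *m 'J f x *m H (f x)).
Proof.
move=> Ux; have Vfx := fUV Ux; have am := a_multilinear Vfx.
have [n0|n0] := eqVneq (chart_norm2 x) 0.
  rewrite (chart_norm_eq0 Ux n0) mulmx0 mul0mx scaler0.
  apply/matrixP => s b; rewrite !mxE (chart_norm_eq0 Ux n0).
  (* Since [k] is at least 2, a second row of the zero Jacobian survives the replacement of row
     [s]. *)
  have [t ts] : exists t : 'I_k, t != s.
    pose t0 : 'I_k := Ordinal (ltnW k_ge2); pose t1 : 'I_k := Ordinal k_ge2.
    by have [->|st] := eqVneq s t0; [exists t1 | exists t0; rewrite eq_sym].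
  by rewrite (@multilinear_row0 _ _ _ _ am t) // row_set_row_neq // row0.
apply/matrixP => s b; rewrite mxE.
pose X (t : R) := t *: delta_mx s b + 'J f x.
have dX : differentiable X 0 by exact: differentiable_line.
have DX : 'D_1 X 0 = delta_mx s b by exact: derive_line.
have X0 : X 0 = 'J f x by rewrite /X scale0r add0r.
have dXT : differentiable (fun t => (X t)^T) 0 by exact: differentiable_trmx.
have dXH : differentiable (fun t => X t *m H (f x)) 0.
  by apply: differentiable_mulmx.
have nm : \forall t \near (0 : R), multilinear (a (f x)) by near=> t.
have da : differentiable (fun t => a (f x) (X t)) 0.
  exact: (@differentiable_multilinear _ _ _ _ (fun=> a (f x))).
have Da : 'D_1 (fun t => a (f x) (X t)) 0 =
    a (f x) (set_row s (delta_mx 0 b) ('J f x)).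
  rewrite (@derive_multilinear _ _ _ _ (fun=> a (f x))) // derive_cst add0r DX X0.
  rewrite (bigD1 s) //= [X in _ + X]big1 => [|t ts]; last first.
    rewrite (_ : row t _ = 0) ?multilinear0 //.
    by apply/rowP => j; rewrite !mxE (negbTE ts).
  rewrite addr0; congr (a _ (set_row s _ _)).
  by apply/rowP => j; rewrite !mxE !eqxx.
rewrite -Da (first_variation Ux n0 da (differentiable_mulmx dXH dXT)); first last.
- near=> t => uQ; apply: comass_le1_bound => //.
  + exact: a_alternating.
  + exact: H_posdef.
  + exact: a_calibration.
- by rewrite X0.
- by rewrite X0.
rewrite derive_mulmx // derive_mulmx // derive_cst mulmx0 addr0 derive_trmx //.
rewrite DX X0 mulmxDr raddfD /=.
(* The two terms of the derivative of the Gram matrix are transposes of each other; their equal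
   traces absorb the factor one half. *)
have -> : \tr (invmx (G x) *m (delta_mx s b *m H (f x) *m ('J f x)^T)) =
    \tr (invmx (G x) *m ('J f x *m H (f x) *m (delta_mx s b)^T)).
  rewrite -mxtrace_tr !trmx_mul trmxK (H_posdef Vfx).1 trmx_inv (G_posdef Ux).1.
  by rewrite mxtrace_mulC !mulmxA.
have -> : \tr (invmx (G x) *m ('J f x *m H (f x) *m (delta_mx s b)^T)) =
    (invmx (G x) *m 'J f x *m H (f x)) s b.
  by rewrite !mulmxA mxtrace_mul_delta.
by rewrite [RHS]mxE; field.
Unshelve. all: by end_near. Qed.

Lemma derive_base_point x b : U x ->
  'D_(delta_mx 0 b) (a^~ ('J f x)) (f x) =
  2^-1 * (c * nu x ^+ (k - 2) * Num.sqrt (\det (G x))) *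
  \tr (invmx (G x) *m
        ('J f x *m 'D_(delta_mx 0 b) H (f x) *m ('J f x)^T)).
Proof.
move=> Ux; have Vfx := fUV Ux; have am := a_multilinear Vfx.
have [n0|n0] := eqVneq (chart_norm2 x) 0.
  rewrite (chart_norm_eq0 Ux n0) !mul0mx mulmx0 mxtrace0 mulr0.
  rewrite -[RHS](derive_cst (0 : R) (f x) (delta_mx 0 b)); apply: near_eq_derive.
  apply: filterS (nearV Vfx) => y /a_multilinear ym.
  by rewrite (@multilinear_row0 _ _ _ _ ym (Ordinal k_ge2)) // row0.
pose l (t : R) : 'rV[R]_n := t *: delta_mx 0 b + f x.
have dl : differentiable l 0 by exact: differentiable_line.
have l0 : l 0 = f x by rewrite /l scale0r add0r.
have Dl : 'D_1 l 0 = delta_mx 0 b by exact: derive_line.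
have da : differentiable (a^~ ('J f x)) (l 0) by rewrite l0; exact: a_diff.
have dH : differentiable H (l 0) by rewrite l0; exact: H_diff.
have dHl : differentiable (fun t => H (l t)) 0 by exact: differentiable_comp.
have dJH : differentiable (fun t => 'J f x *m H (l t)) 0.
  by apply: differentiable_mulmx.
have := derive_comp (1 : R) dl da; rewrite Dl l0 => <-.
rewrite (first_variation Ux n0 (Q := fun t => 'J f x *m H (l t) *m ('J f x)^T)).
- rewrite derive_mulmx // derive_cst mulmx0 addr0 derive_mulmx // derive_cst.
  by rewrite mul0mx add0r (derive_comp (1 : R) dl dH) Dl l0.
- exact: (differentiable_comp dl da).
- by apply: differentiable_mulmx.
- by rewrite l0.
- by rewrite l0.
have nV : \forall t \near 0, V (l t).
  by apply: (differentiable_continuous dl); rewrite l0; exact: nearV.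
apply: filterS nV => t Vt uQ; apply: comass_le1_bound => //.
- exact: a_multilinear.
- exact: a_alternating.
- exact: H_posdef.
- exact: a_calibration.
Qed.

Let JE x v : U x -> v *m 'J f x = 'D_v f x.
Proof. by move=> /f_diff /deriveEjacobian ->. Qed.

Let rowJ x s : U x -> row s ('J f x) = 'D_(delta_mx 0 s) f x.
Proof. by move=> Ux; rewrite rowE JE. Qed.

Lemma differentiable_jacobian x : U x -> differentiable (fun z => 'J f z) x.
Proof.
move=> Ux; apply/differentiable_mxP => s j.
apply: (@near_eq_differentiable _ _ _ (fun z => ('D_(delta_mx 0 s) f z) 0 j)).
  by apply: filterS (nearU Ux) => z Uz; rewrite -rowJ // mxE.
exact: ((differentiable_mxP _ _).1 (f_diff2 _ Ux)).
Qed.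

Lemma row_derive_jacobian x s v : U x ->
  row s ('D_v (fun z => 'J f z) x) = 'D_v (fun z => 'D_(delta_mx 0 s) f z) x.
Proof.
move=> Ux; apply/rowP => j; rewrite mxE derive_mxE; last first.
  exact: differentiable_jacobian.
rewrite derive_mxE; last exact: f_diff2.
apply: near_eq_derive; apply: filterS (nearU Ux) => z Uz.
by rewrite -(rowJ s Uz) [RHS]mxE.
Qed.

Lemma derive2_sym x v w : U x ->
  'D_w (fun z => 'D_v f z) x = 'D_v (fun z => 'D_w f z) x.
Proof.
move=> Ux; apply/rowP => j.
have E u : \forall z \near x, ('D_u f z) 0 j = 'D_u (fun z => f z 0 j) z.
  by apply: filterS (nearU Ux) => z Uz; rewrite derive_mxE //; exact: f_diff.
have D2E u u' : ('D_u' (fun z => 'D_u f z) x) 0 j =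
    'D_u' (fun z => 'D_u (fun z => f z 0 j) z) x.
  exact: etrans (derive_mxE _ _ _ (f_diff2 u Ux)) (near_eq_derive _ (E u)).
have D u : differentiable (fun z => 'D_u (fun z => f z 0 j) z) x.
  apply: near_eq_differentiable (E u) _.
  exact: ((differentiable_mxP _ _).1 (f_diff2 _ Ux)).
apply: etrans (D2E v w) (etrans _ (esym (D2E w v))).
apply: derive_sym => //; apply: filterS (nearU Ux) => z Uz.
exact: ((differentiable_mxP _ _).1 (f_diff Uz)).
Qed.

Let set_row_jacobian_diff x s b : U x ->
  differentiable (fun z => set_row s (delta_mx 0 b) ('J f z)) x.
Proof.
move=> Ux; apply/differentiable_mxP => t j.
under eq_fun do rewrite mxE; case: eqP => _; first exact: differentiable_cst.
exact: ((differentiable_mxP _ _).1 (differentiable_jacobian Ux)).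
Qed.

Let row_derive_set_row x s b v t : U x ->
  row t ('D_v (fun z => set_row s (delta_mx 0 b) ('J f z)) x) =
  if t == s then 0 else 'D_v (fun z => 'D_(delta_mx 0 t) f z) x.
Proof.
move=> Ux; apply/rowP => j; rewrite mxE derive_mxE; last first.
  exact: set_row_jacobian_diff.
under eq_fun do rewrite mxE; case: eqP => _; first by rewrite derive_cst mxE.
rewrite -row_derive_jacobian // mxE derive_mxE //.
exact: differentiable_jacobian.
Qed.

Let af_diff x X : U x -> differentiable (fun z => a (f z) X) x.
Proof.
move=> Ux.
exact: (differentiable_comp (f_diff Ux) (a_diff X (fUV Ux))).
Qed.

Lemma differentiable_polarization x : U x -> differentiable polarization x.
Proof.
move=> Ux; apply/differentiable_mxP => s b; under eq_fun do rewrite mxE.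
apply: (@differentiable_multilinear _ _ _ _ (fun z => a (f z))) => //.
- exact: a_near.
- by move=> Z; exact: af_diff.
- exact: set_row_jacobian_diff.
Qed.

(** Closedness evaluated on the family formed by the basis vector [b] followed by the rows of the
    Jacobian; [alternating_row'] then moves that vector to each place [s]. *)
Lemma closed_expand x b : U x ->
  'D_(delta_mx 0 b) (a^~ ('J f x)) (f x) =
  \sum_s 'D_(row s ('J f x))
     (a^~ (set_row s (delta_mx 0 b) ('J f x))) (f x).
Proof.
move=> Ux; have Vfx := fUV Ux.
have := a_closed Vfx (col_mx (delta_mx 0 b : 'rV_n) ('J f x) : 'M[R]_(1 + k, n)).
rewrite big_ord_recl expr0 mul1r.
have -> : row ord0 (col_mx (delta_mx 0 b : 'rV_n) ('J f x) : 'M[R]_(1 + k, n)) =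
    delta_mx 0 b.
  by apply/rowP => j; rewrite mxE; exact: col_mx_ord0.
have -> : row' ord0 (col_mx (delta_mx 0 b : 'rV_n) ('J f x) : 'M[R]_(1 + k, n)) =
    'J f x.
  by apply/matrixP => i j; rewrite mxE; exact: col_mx_lift0.
move/eqP; rewrite addr_eq0 => /eqP ->; rewrite -sumrN; apply: eq_bigr => s _.
have -> : row (lift ord0 s)
    (col_mx (delta_mx 0 b : 'rV_n) ('J f x) : 'M[R]_(1 + k, n)) = row s ('J f x).
  by apply/rowP => j; rewrite mxE [RHS]mxE; exact: col_mx_lift0.
rewrite (@near_eq_derive _ _ _ _ (fun z => (-1) ^+ s *
    a z (set_row s (delta_mx 0 b) ('J f x)))); last first.
  apply: filterS (nearV Vfx) => y Vy; apply: alternating_row'.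
    exact: a_multilinear.
  exact: a_alternating.
rewrite derive_mul //; last exact: a_diff.
(* The sign of the exterior derivative and that of the move have total exponent [2 s + 1], and the
   minus sign left over cancels the one from transposing the sum. *)
rewrite derive_cst mulr0 addr0 mulrA -exprD /= /bump /= add1n addSn exprS.
by rewrite mulN1r addnn -mul2n exprM sqrrN expr1n expr1n mulN1r opprK.
Qed.

(** The null Lagrangian identity: the derivatives of the coefficients of the form add up by
    [closed_expand], and the terms with second derivatives of [f] cancel in pairs. *)
Lemma divergence_polarization x b : U x ->
  \sum_s 'D_(delta_mx 0 s) (fun z => polarization z s b) x =
  'D_(delta_mx 0 b) (a^~ ('J f x)) (f x).
Proof.
move=> Ux; have Vfx := fUV Ux; have am := a_multilinear Vfx.
pose w : 'rV[R]_n := delta_mx 0 b.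
pose D2 s t := 'D_(delta_mx 0 s) (fun z => 'D_(delta_mx 0 t) f z) x.
(* Row [s] holds a constant basis vector, so it contributes nothing when [t] is [s]. For the other
   indices alternation and the symmetry of [D2] make [q] antisymmetric. *)
pose q s t := if t == s then 0 else
  a (f x) (set_row t (D2 s t) (set_row s w ('J f x))).
have DW s : 'D_(delta_mx 0 s) (fun z => polarization z s b) x =
    'D_(row s ('J f x)) (a^~ (set_row s w ('J f x))) (f x) + \sum_t q s t.
  under eq_fun do rewrite mxE.
  rewrite (@derive_multilinear _ _ _ _ (fun z => a (f z))); first last.
  - exact: set_row_jacobian_diff.
  - by move=> Z; exact: af_diff.
  - exact: a_near.
  rewrite (derive_comp _ (f_diff Ux) (a_diff _ Vfx)) -rowJ //; congr (_ + _).
  apply: eq_bigr => t _; rewrite row_derive_set_row // /q.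
  by case: eqP => // _; rewrite multilinear0.
have D2C s t : D2 s t = D2 t s.
  exact: (derive2_sym (delta_mx 0 t) (delta_mx 0 s) Ux).
have qN s t : q s t = - q t s.
  rewrite /q eq_sym; case: eqVneq => [_|st]; first by rewrite oppr0.
  have ts : t != s by rewrite eq_sym.
  rewrite (alternatingC am (a_alternating Vfx) _ _ _ ts) (set_rowC _ _ _ ts).
  by rewrite D2C.
have q0 : \sum_s \sum_t q s t = 0.
  suff : \sum_s \sum_t q s t = - \sum_s \sum_t q s t by lra.
  rewrite [LHS]exchange_big /= -sumrN; apply: eq_bigr => s _.
  by rewrite -sumrN; apply: eq_bigr => t _.
rewrite (eq_bigr _ (fun s _ => DW s)) big_split /= q0 addr0.
by rewrite closed_expand.
Qed.

Definition stress x : 'M[R]_(k, n) := nu x ^+ (k - 2) *: 'J f x.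

(** The stress with its index on the domain raised by [G] and its index on the target lowered by
    [H]; multiplied by [c * sG x] it is the polarization. *)
Definition flux x : 'M[R]_(k, n) := invmx (G x) *m stress x *m H (f x).

Let sG x := Num.sqrt (\det (G x)).

Let sG_gt0 x : U x -> 0 < sG x.
Proof. by move=> Ux; rewrite sqrtr_gt0 posdef_det_gt0 //; exact: G_posdef. Qed.

Let polarization_flux x : U x -> polarization x = (c * sG x) *: flux x.
Proof.
move=> Ux; rewrite polarizationE // /flux /stress -scalemxAr -scalemxAl scalerA.
by congr (_ *: _); rewrite mulrAC.
Qed.

Let sG_diff x : U x -> differentiable sG x.
Proof.
move=> Ux; apply: differentiable_sqrt; first exact/differentiable_det/G_diff.
exact/posdef_det_gt0/G_posdef.
Qed.

Let sG_derive x v : U x ->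
  'D_v sG x = 2^-1 * sG x * \tr (invmx (G x) *m 'D_v G x).
Proof.
move=> Ux; have dG := G_diff Ux; have Gd := posdef_det_gt0 (G_posdef Ux).
rewrite derive_sqrt_comp //; last exact: differentiable_det.
rewrite derive_det_unit //; last exact/posdef_unit/G_posdef.
have := sG_gt0 Ux; rewrite -/(sG x).
have -> : \det (G x) = sG x ^+ 2 by rewrite sqr_sqrtr // ltW.
by move=> s0; field; rewrite gt_eqF.
Qed.

Lemma differentiable_flux x : U x -> differentiable flux x.
Proof.
move=> Ux.
apply: (@near_eq_differentiable _ _ _ (fun z => (c * sG z)^-1 *: polarization z)).
  apply: filterS (nearU Ux) => z Uz; rewrite polarization_flux // scalerA.
  by rewrite mulVf ?scale1r // gt_eqF // mulr_gt0 // sG_gt0.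
apply: differentiable_scale; last exact: differentiable_polarization.
apply: differentiableV; first by apply: differentiable_mul => //; exact: sG_diff.
by rewrite gt_eqF // mulr_gt0 // sG_gt0.
Qed.

Lemma stress_metric x : U x -> stress x *m H (f x) = G x *m flux x.
Proof.
by move=> Ux; rewrite /flux !mulmxA mulmxV ?mul1mx //; exact/posdef_unit/G_posdef.
Qed.

(* The factor [nu x ^+ (k - 2)] need not be differentiable where ['J f]
   vanishes, but [flux] is a smooth multiple of [polarization]. *)
Lemma differentiable_stress x : U x -> differentiable stress x.
Proof.
move=> Ux; have Vfx := fUV Ux.
apply: (@near_eq_differentiable _ _ _ (fun z => G z *m flux z *m invmx (H (f z)))).
  apply: filterS (nearU Ux) => z Uz; rewrite -stress_metric // mulmxK //.
  exact/posdef_unit/H_posdef/fUV.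
apply: differentiable_mulmx.
  by apply: differentiable_mulmx; [exact: G_diff | exact: differentiable_flux].
apply: differentiable_invmx; last exact/posdef_unit/H_posdef.
exact: (differentiable_comp (f_diff Ux) (H_diff Vfx)).
Qed.

(** This is [divergence_polarization] divided by [c * sG x]: the derivative of the density [sG]
    gives the trace term on the left, and [derive_base_point] evaluates the right side. *)
Lemma euler_lagrange x b : U x ->
  \sum_s ('D_(delta_mx 0 s) (fun z => flux z s b) x +
    2^-1 * \tr (invmx (G x) *m 'D_(delta_mx 0 s) G x) * flux x s b) =
  2^-1 * \tr (invmx (G x) *m
    (stress x *m 'D_(delta_mx 0 b) H (f x) *m ('J f x)^T)).
Proof.
move=> Ux; have cs0 : c * sG x != 0 by rewrite gt_eqF // mulr_gt0 // sG_gt0.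
apply: (mulfI cs0); rewrite mulr_sumr.
have dF s : differentiable (fun z => flux z s b) x.
  exact: ((differentiable_mxP _ _).1 (differentiable_flux Ux)).
have dcs : differentiable (fun z => c * sG z) x.
  by apply: differentiable_mul => //; exact: sG_diff.
transitivity (\sum_s 'D_(delta_mx 0 s) (fun z => polarization z s b) x).
  apply: eq_bigr => s _.
  rewrite [RHS](@near_eq_derive _ _ _ _ (fun z => c * sG z * flux z s b)).
    rewrite derive_mul // derive_mul //; last exact: sG_diff.
    rewrite derive_cst mulr0 addr0 sG_derive //.
    by move: ('D_(delta_mx 0 s) _ x) => D; field.
  by apply: filterS (nearU Ux) => z Uz; rewrite polarization_flux // mxE.
rewrite divergence_polarization // derive_base_point // /stress -!scalemxAl.
rewrite -scalemxAr mxtraceZ -/(sG x).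
by move: (\tr _) => D; field.
Qed.

End SmithChart.

(** * The Levi-Civita connections *)

Section MetricInChart.
Variables (R : realType) (n : nat) (M : manifold R n) (h : riemannian_metric M).
Variables (i : chart M) (p : M) (ip : chart_dom i p).

Lemma metric_posdef : posdef (h i p).
Proof. by split; [exact: Defs.metric_sym | exact: metric_pos]. Qed.

Lemma metric_differentiable :
  differentiable (fun y => h i (chart_inv i y)) (chart_map i p).
Proof. by have [+ _] := metric_smooth h i 1; apply; exists p. Qed.

Lemma connection_delta a :
  connection h i p (delta_mx 0 a) = \matrix_(b, d) christoffel h i p a b d.
Proof.
apply/matrixP => b d; rewrite !mxE (bigD1 a) //= mxE !eqxx mul1r.
by rewrite big1 ?addr0 // => c ca; rewrite mxE (negbTE ca) andbF mul0r.
Qed.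

Lemma connection_lin v :
  connection h i p v = \sum_a v 0 a *: connection h i p (delta_mx 0 a).
Proof.
apply/matrixP => b d; rewrite mxE summxE; apply: eq_bigr => a _.
by rewrite connection_delta !mxE.
Qed.

(** Compatibility with the metric in matrix form, read off from [christoffelP] applied to
    [christoffel] itself. *)
Lemma connection_metric v :
  'D_v (fun y => h i (chart_inv i y)) (chart_map i p) =
  connection h i p v *m h i p + (connection h i p v *m h i p)^T.
Proof.
rewrite (derive_lin _ metric_differentiable) connection_lin mulmx_suml.
rewrite (raddf_sum (@trmx _ _ _)) -big_split; apply: eq_bigr => a _ /=.
rewrite -scalemxAl linearZ -scalerDr; congr (_ *: _).
apply/matrixP => b c; rewrite derive_mxE; last exact: metric_differentiable.
rewrite connection_delta !mxE.
have [_ compat] := (christoffelP h ip _).2 (fun a b d => erefl).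
rewrite [LHS](compat a b c); congr (_ + _); apply: eq_bigr => d _.
  by rewrite !mxE.
by rewrite !mxE (metric_symE h ip b).
Qed.

(** Of the three derivatives in a lowered Christoffel symbol, two cancel against the symmetric [N].
    It is applied on the domain to the inverse metric and on the target to the pushed forward
    stress. *)
Lemma christoffel_trace (N : 'M[R]_n) c : N^T = N ->
  (\sum_a row a N *m (connection h i p (delta_mx 0 a) *m h i p)^T) 0 c =
  2^-1 * \tr (N *m
    'D_(delta_mx 0 c) (fun y => h i (chart_inv i y)) (chart_map i p)).
Proof.
move=> Ns; have NC a b : N a b = N b a by rewrite -{1}Ns mxE.
rewrite summxE.
transitivity (\sum_a \sum_b N a b * (2^-1 * (metric_deriv h i p a c b
    + metric_deriv h i p c a b - metric_deriv h i p b a c))).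
  apply: eq_bigr => a _; rewrite mxE; apply: eq_bigr => b _.
  rewrite -christoffel_lowered // connection_delta !mxE; congr (_ * _).
  by apply: eq_bigr => d _; rewrite mxE.
have -> : \tr (N *m
    'D_(delta_mx 0 c) (fun y => h i (chart_inv i y)) (chart_map i p)) =
    \sum_a \sum_b N a b * metric_deriv h i p c a b.
  apply: eq_bigr => a _; rewrite mxE; apply: eq_bigr => b _.
  rewrite derive_mxE ?(metric_deriv_sym h ip c a b) //.
  exact: metric_differentiable.
have E : \sum_a \sum_b N a b * metric_deriv h i p b a c =
    \sum_a \sum_b N a b * metric_deriv h i p a c b.
  rewrite exchange_big; apply: eq_bigr => a _; apply: eq_bigr => b _.
  by rewrite NC (metric_deriv_sym h ip a b c).
have -> : \sum_a \sum_b N a b * (2^-1 * (metric_deriv h i p a c b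
    + metric_deriv h i p c a b - metric_deriv h i p b a c)) =
   2^-1 * (\sum_a \sum_b N a b * metric_deriv h i p a c b +
   \sum_a \sum_b N a b * metric_deriv h i p c a b -
   \sum_a \sum_b N a b * metric_deriv h i p b a c).
  rewrite -big_split -sumrB mulr_sumr; apply: eq_bigr => a _ /=.
  rewrite -big_split -sumrB mulr_sumr; apply: eq_bigr => b _ /=.
  by ring.
by rewrite E addrAC subrr add0r.
Qed.

End MetricInChart.

Lemma zmod_cancel (V : zmodType) (X Y Z P Q : V) :
  X + Y + Z - (P + Q) - X + P = Y + Z - Q.
Proof.
rewrite -(addrA X) (addrAC _ (- (P + Q))) (addrC X) addrK opprD addrA.
by rewrite addrAC subrK.
Qed.

(** * From the manifolds to a pair of charts *)

Section ChartExpression.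
Variables (R : realType) (k n : nat) (L : manifold R k) (M : manifold R n).
Variables (g : riemannian_metric L) (h : riemannian_metric M) (u : L -> M).
Variables (i : chart L) (j : chart M).

Local Notation dom := (chart_dom i `&` u @^-1` chart_dom j).
Local Notation f := (chart_map j \o u \o chart_inv i).
Local Notation G := (fun x => g i (chart_inv i x)).
Local Notation H := (fun y => h j (chart_inv j y)).

Lemma chart_preimage_open : continuous u -> open (chart_map i @` dom).
Proof.
move=> uc; rewrite openE => _ [p [ip jp] <-].
have n1 : nbhs (chart_map i p) (chart_map i @` chart_dom i).
  by apply: open_nbhs_nbhs; split; [exact: chart_im_open | exists p].
have n2 : nbhs (chart_map i p) (chart_inv i @^-1` (u @^-1` chart_dom j)).
  apply: (chart_inv_continuous ip); rewrite chart_mapK //.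
  by apply: uc; apply: open_nbhs_nbhs; split => //; exact: chart_dom_open.
apply: filterS2 n1 n2 => _ [q iq <-] /=; rewrite chart_mapK // => jq.
by exists q.
Qed.

Lemma chart_domP p : dom p -> chart_inv j (f (chart_map i p)) = u p.
Proof. by move=> [ip jp]; rewrite /= !chart_mapK. Qed.

Lemma du_normE p : dom p ->
  du_norm g h u i j p = Num.sqrt (chart_norm2 f G H (chart_map i p)).
Proof.
move=> dp; rewrite /du_norm /du_norm2 /chart_norm2 (chart_domP dp).
by rewrite chart_mapK //; case: dp.
Qed.

Lemma stressE p : dom p ->
  du_norm g h u i j p ^+ (k - 2) *: du u i j p = stress f G H (chart_map i p).
Proof. by move=> dp; rewrite du_normE. Qed.

Lemma smith_chart (alpha : diff_form M k) : (2 <= k)%N ->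
  calibration h alpha -> smith_immersion g h u alpha -> closed_form alpha ->
  forall p, dom p ->
  [/\ differentiable (stress f G H) (chart_map i p),
      differentiable (flux f G H) (chart_map i p) &
      forall b, let x := chart_map i p in
      \sum_s ('D_(delta_mx 0 s) (fun z => flux f G H z s b) x +
        2^-1 * \tr (invmx (G x) *m 'D_(delta_mx 0 s) G x) * flux f G H x s b) =
      2^-1 * \tr (invmx (G x) *m
        (stress f G H x *m 'D_(delta_mx 0 b) H (f x) *m ('J f x)^T))].
Proof.
move=> k2 cal [[uc usm] sm] closed.
pose U := chart_map i @` dom; pose V := chart_map j @` chart_dom j.
pose a y X := alpha j (chart_inv j y) X.
have Uo : open U by exact: chart_preimage_open.
have Vo : open V by exact: chart_im_open.
have fUV x : U x -> V (f x).
  by move=> [q [iq jq] <-] /=; rewrite chart_mapK //; exists (u q).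
have fd x : U x -> differentiable f x by have [+ _] := usm i j 1; apply.
have fd2 v x : U x -> differentiable (fun y => 'D_v f y) x.
  by have [_ /(_ v)[+ _]] := usm i j 2; apply.
have Gd x : U x -> differentiable G x.
  by move=> [q [iq _] <-]; exact: metric_differentiable.
have Gp x : U x -> posdef (G x).
  by move=> [q [iq _] <-]; rewrite chart_mapK //; exact: metric_posdef.
have Hd y : V y -> differentiable H y.
  by move=> [q jq <-]; exact: metric_differentiable.
have Hp y : V y -> posdef (H y).
  by move=> [q jq <-]; rewrite chart_mapK //; exact: metric_posdef.
have am y : V y -> multilinear (a y).
  by move=> [q jq <-]; rewrite /a chart_mapK //; exact: form_multilinear.
have aa y : V y -> alternating (a y).
  by move=> [q jq <-]; rewrite /a chart_mapK //; exact: form_alternate.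
have ad X y : V y -> differentiable (a^~ X) y.
  by have [+ _] := form_smooth alpha j X 1; apply.
have ac y : V y -> forall X : 'M[R]_(k.+1, n),
    \sum_(s < k.+1) (-1) ^+ s * 'D_(row s X) (fun z => a z (row' s X)) y = 0.
  by move=> [q jq <-] X; exact: closed.
have acal y : V y -> forall E, E *m H y *m E^T = 1%:M -> a y E <= 1.
  by move=> [q jq <-] E; rewrite /a chart_mapK //; exact: cal.
have fconf x : U x -> 'J f x *m H (f x) *m ('J f x)^T =
    (k%:R^-1 * chart_norm2 f G H x) *: G x.
  move=> [q [iq jq] <-]; have [_] := sm i j q iq jq.
  rewrite /pullback_metric /du_norm2 /chart_norm2 /pullback_metric.
  by rewrite (chart_domP (conj iq jq)) (chart_mapK iq).
have fcal x : U x -> a (f x) ('J f x) = (Num.sqrt k%:R ^+ k)^-1 *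
    Num.sqrt (chart_norm2 f G H x) ^+ k * Num.sqrt (\det (G x)).
  (* The identity between top forms is evaluated on the coordinate frame, the identity matrix. *)
  move=> [q [iq jq] <-]; have [/(_ 1%:M) + _] := sm i j q iq jq.
  rewrite /pullback_form mul1mx /vol_form det1 mulr1 (du_normE (conj iq jq)).
  by rewrite /a (chart_domP (conj iq jq)) (chart_mapK iq).
move=> p dp; have Up : U (chart_map i p) by exists p.
split.
- exact: (differentiable_stress k2 Uo fUV fd fd2 Gd Gp Hd Hp am aa ad acal
    fconf fcal).
- exact: (differentiable_flux k2 Uo fUV fd fd2 Gd Gp Hp am aa ad acal
    fconf fcal).
- move=> b; exact: (euler_lagrange k2 Uo Vo fUV fd fd2 Gd Gp Hd Hp am aa ad ac
    acal fconf fcal).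
Qed.

End ChartExpression.

(** * The divergence in coordinate vectors *)

Section Divergence.
Variables (R : realType) (k n : nat) (L : manifold R k) (M : manifold R n).
Variables (g : riemannian_metric L) (h : riemannian_metric M) (u : L -> M).
Variables (A : chart L -> chart M -> L -> 'M[R]_(k, n)).
Variables (i : chart L) (j : chart M) (p : L).

Lemma cov_deriv_lin v : differentiable (A i j \o chart_inv i) (chart_map i p) ->
  cov_deriv g h u A i j p v =
  \sum_a v 0 a *: cov_deriv g h u A i j p (delta_mx 0 a).
Proof.
move=> dA; rewrite /cov_deriv (derive_lin _ dA).
have -> : connection g i p v *m A i j p =
    \sum_a v 0 a *: (connection g i p (delta_mx 0 a) *m A i j p).
  rewrite connection_lin mulmx_suml; apply: eq_bigr => a _.
  by rewrite scalemxAl.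
have -> : A i j p *m connection h j (u p) (v *m du u i j p) =
    \sum_a v 0 a *: (A i j p *m
      connection h j (u p) (delta_mx 0 a *m du u i j p)).
  rewrite connection_lin mulmx_sumr.
  under [RHS]eq_bigr do rewrite connection_lin mulmx_sumr scaler_sumr.
  rewrite exchange_big; apply: eq_bigr => b _ /=.
  rewrite -scalemxAr mxE scaler_suml; apply: eq_bigr => a _.
  have -> : ((delta_mx 0 a : 'rV[R]_k) *m du u i j p) 0 b = du u i j p a b.
    by rewrite -rowE mxE.
  by rewrite -scalemxAr scalerA.
rewrite -sumrB -big_split; apply: eq_bigr => a _ /=.
by rewrite scalerDr scalerBr.
Qed.

(** Each frame vector is expanded in coordinate vectors, and the products of the coefficients sum to
    the inverse metric by [orthonormal_inv]. *)
Lemma divergence_inv_metric (E : 'M[R]_k) : chart_dom i p ->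
  Defs.orthonormal g i p E ->
  differentiable (A i j \o chart_inv i) (chart_map i p) ->
  divergence g h u A i j p E =
  \sum_a row a (invmx (g i p)) *m cov_deriv g h u A i j p (delta_mx 0 a).
Proof.
move=> ip oE dA; rewrite -(orthonormal_inv ip oE) /divergence.
under eq_bigr => s _ do rewrite (cov_deriv_lin _ dA) mulmx_sumr.
rewrite exchange_big; apply: eq_bigr => a _ /=.
rewrite row_mul [row a E^T *m E]mulmx_sum_row mulmx_suml; apply: eq_bigr => s _.
by rewrite -scalemxAr -scalemxAl !mxE.
Qed.

End Divergence.

(** * Vanishing of the k-tension *)

Theorem theorem3p9 (R : realType) (k n : nat)
    (two_le_k : (2 <= k)%N) (k_le_n : (k <= n)%N)
    (L : manifold R k) (M : manifold R n)
    (L_oriented : oriented L) (M_oriented : oriented M)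
    (g : riemannian_metric L) (h : riemannian_metric M)
    (alpha : diff_form M k) (alpha_calibration : calibration h alpha)
    (u : L -> M) (u_smith : smith_immersion g h u alpha)
    (alpha_closed : closed_form alpha) :
  k_harmonic g h u.
Proof.
move=> i j p ip jp E oE.
have [dS dF EL] :=
  smith_chart two_le_k alpha_calibration u_smith alpha_closed (conj ip jp).
have [[uc usm] _] := u_smith.
pose dom : set L := chart_dom i `&` u @^-1` chart_dom j.
pose U := chart_map i @` dom.
pose f := chart_map j \o u \o chart_inv i.
pose x := chart_map i p.
pose G := fun x => g i (chart_inv i x); pose H := fun y => h j (chart_inv j y).
have dp : dom p by [].
have nU : \forall z \near x, U z.
  by apply: open_nbhs_nbhs; split; [exact: chart_preimage_open | exists p].
have fx : f x = chart_map j (u p) by rewrite /f /x /= chart_mapK.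
have Gx : G x = g i p by rewrite /G /x chart_mapK.
have Hx : H (f x) = h j (u p) by rewrite /H (chart_domP dp).
have Jx : 'J f x = du u i j p by [].
pose A (i : chart L) (j : chart M) p :=
  du_norm g h u i j p ^+ (k - 2) *: du u i j p.
have AE : \forall z \near x, stress f G H z = (A i j \o chart_inv i) z.
  apply: filterS nU => _ [q dq <-] /=; rewrite (chart_mapK dq.1).
  exact/esym/stressE.
have dA : differentiable (A i j \o chart_inv i) x.
  exact: near_eq_differentiable AE dS.
rewrite /k_tension (divergence_inv_metric h u ip oE dA).
set Gi := invmx (g i p); set S := stress f G H x; set F := flux f G H x.
have Ap : A i j p = S by exact: stressE.
have uH := metric_unit h jp.
(* Lowering the target index by the invertible [h] loses nothing and lets the flux replace the
   stress. *)
apply: (can_inj (mulmxK uH)); rewrite mul0mx mulmx_suml.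
have df : differentiable f x by have [+ _] := usm i j 1; apply; exists p.
have dG : differentiable G x by exact: metric_differentiable.
have dH : differentiable H (f x) by rewrite fx; exact: metric_differentiable.
have dHf : differentiable (fun z => H (f z)) x.
  exact: (differentiable_comp df dH).
have Gp z : U z -> posdef (G z).
  by move=> [q [iq _] <-]; rewrite /G chart_mapK //; exact: metric_posdef.
have SH : S *m h j (u p) = g i p *m F.
  by rewrite -Hx -Gx; apply: (stress_metric _ _ Gp); exists p.
(* Differentiate [S *m H = G *m F] and express the derivatives of both metrics by their connections:
   on each side one connection term cancels against that in [cov_deriv], and its transposed partner
   remains. *)
have covH a : cov_deriv g h u A i j p (delta_mx 0 a) *m h j (u p) =
    (connection g i p (delta_mx 0 a) *m g i p)^T *m F
    + g i p *m 'D_(delta_mx 0 a) (flux f G H) x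
    - S *m (connection h j (u p) (delta_mx 0 a *m du u i j p) *m h j (u p))^T.
  have DE : 'D_(delta_mx 0 a) (A i j \o chart_inv i) x =
      'D_(delta_mx 0 a) (stress f G H) x by exact/esym/near_eq_derive.
  have DSH : 'D_(delta_mx 0 a) (stress f G H) x *m H (f x)
      + S *m 'D_(delta_mx 0 a) (fun z => H (f z)) x =
      'D_(delta_mx 0 a) G x *m F + G x *m 'D_(delta_mx 0 a) (flux f G H) x.
    apply: etrans (esym (derive_mulmx _ dS dHf)) (etrans _ (derive_mulmx _ dG dF)).
    apply: near_eq_derive.
    by apply: filterS nU => z Uz; exact: (stress_metric _ _ Gp).
  have DHf : 'D_(delta_mx 0 a) (fun z => H (f z)) x =
      'D_(delta_mx 0 a *m du u i j p) H (f x).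
    by rewrite (derive_comp _ df dH) -Jx deriveEjacobian.
  have DG : 'D_(delta_mx 0 a) G x = _ := connection_metric g ip (delta_mx 0 a).
  have DH := connection_metric h jp (delta_mx 0 a *m du u i j p).
  rewrite DHf fx DH DG -fx Hx Gx in DSH.
  rewrite /cov_deriv mulmxDl mulmxBl DE Ap (canRL (addrK _) DSH).
  rewrite -(mulmxA _ S) SH -(mulmxA S) mulmxDl mulmxDr -(mulmxA _ (g i p) F).
  by rewrite zmod_cancel.
under eq_bigr => a _ do rewrite -mulmxA covH mulmxBr mulmxDr.
rewrite sumrB big_split /=.
set C1 := \sum_a row a Gi *m (connection g i p (delta_mx 0 a) *m g i p)^T.
have -> : \sum_a row a Gi *m
    ((connection g i p (delta_mx 0 a) *m g i p)^T *m F) = C1 *m F.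
  by rewrite mulmx_suml; apply: eq_bigr => a _; rewrite mulmxA.
have -> : \sum_a row a Gi *m (g i p *m 'D_(delta_mx 0 a) (flux f G H) x) =
    \sum_a row a ('D_(delta_mx 0 a) (flux f G H) x).
  apply: eq_bigr => a _.
  by rewrite -row_mul mulmxA mulVmx ?mul1mx //; exact: metric_unit.
(* All target connection terms are gathered by target direction; [N] is [|du|^(k-2)] times the
   inverse metric of the domain pushed forward by [du], hence symmetric as [christoffel_trace]
   requires. *)
pose N := (du u i j p)^T *m (Gi *m S).
have NE : \sum_a row a Gi *m (S *m
    (connection h j (u p) (delta_mx 0 a *m du u i j p) *m h j (u p))^T) =
    \sum_r row r N *m (connection h j (u p) (delta_mx 0 r) *m h j (u p))^T.
  under eq_bigr => a _ do
    rewrite connection_lin mulmx_suml (raddf_sum (@trmx _ _ _)) mulmxA mulmx_sumr.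
  rewrite exchange_big; apply: eq_bigr => r _ /=.
  have -> : row r N = \sum_a du u i j p a r *: row a (Gi *m S).
    rewrite /N row_mul mulmx_sum_row; apply: eq_bigr => a _.
    by congr (_ *: _); rewrite !mxE.
  rewrite mulmx_suml; apply: eq_bigr => a _.
  have -> : ((delta_mx 0 a : 'rV[R]_k) *m du u i j p) 0 r = du u i j p a r.
    by rewrite -rowE mxE.
  rewrite [row a (Gi *m S)]row_mul; move: (row a Gi *m S) (du u i j p a r) => X t.
  by rewrite -!scalemxAl [in LHS]linearZ -scalemxAr.
have Ns : N^T = N.
  rewrite /N /S /stress -Jx -scalemxAr -scalemxAr linearZ /=; congr (_ *: _).
  by rewrite !trmx_mul trmxK trmx_inv Defs.metric_sym // mulmxA.
rewrite NE; apply/rowP => e; rewrite !mxE summxE.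
rewrite christoffel_trace // -/H -fx.
have -> : N *m 'D_(delta_mx 0 e) H (f x) =
  (du u i j p)^T *m (Gi *m (S *m 'D_(delta_mx 0 e) H (f x))).
  by rewrite /N !mulmxA.
rewrite mxtrace_mulC.
(* By [christoffel_trace] the target terms are exactly the right side of the Euler-Lagrange
   equation; the same lemma with the inverse metric of the domain matches [C1] with the trace term
   on its left. *)
have ELe : \sum_s ('D_(delta_mx 0 s) (fun z => flux f G H z s e) x +
    2^-1 * \tr (invmx (G x) *m 'D_(delta_mx 0 s) G x) * F s e) =
    2^-1 * \tr (invmx (G x) *m (S *m 'D_(delta_mx 0 e) H (f x) *m ('J f x)^T)).
  exact: EL.
rewrite Gx Jx -/Gi (mulmxA Gi) in ELe; rewrite -ELe.
apply/eqP; rewrite subr_eq0; apply/eqP; rewrite addrC -big_split.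
apply: eq_bigr => a _ /=.
rewrite mxE derive_mxE //; congr (_ + _ * _).
rewrite christoffel_trace //.
by rewrite trmx_inv Defs.metric_sym.
Qed.
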